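(* Let $B=\mathbb{Z}[\rho]\langle x,y\rangle/(xy-\rho yx-1)$ and let $C=\mathbb{Z}[\rho][x^p,y^p]$ be its center, with fraction field $K$. Then $B$ is a maximal $C$-order (in the central simple $K$-algebra $B\otimes_CK$).
   Context: $p$ is a prime, $\rho$ is a primitive $p$-th root of one, $\mathbb{Z}[\rho]=\mathbb{Z}[X]/(X^{p-1}+\cdots+1)$. $\mathbb{Z}[\rho]\langle x,y\rangle$ is the free associative algebra, and $B$ is its quotient by the two-sided ideal generated by $xy-\rho yx-1$. The center $C$ of $B$ is a polynomial ring over $\mathbb{Z}[\rho]$ in $x^p$ and $y^p$, and $B$ is free of rank $p^2$ over $C$. *)

(* Defs.v *)
From HB Require Import structures.
From mathcomp Require Import all_boot all_order all_algebra.
From mathcomp Require Import generic_quotient ring_quotient qpoly.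
From mathcomp.multinomials Require Import monalg.
From mathcomp.classical Require Import boolp.

Set Implicit Arguments.
Unset Strict Implicit.
Unset Printing Implicit Defensive.

Import GRing.Theory.
Local Open Scope ring_scope.

                                                                              
                                                                            
                                                        
Section PrincipalQuotient.
Variables (R : nzRingType) (r : R).

Definition ideal2_pred (z : R) : bool :=
  `[< exists s : seq (R * R), z = \sum_(u <- s) u.1 * r * u.2 >].
Definition ideal2 : {pred R} := ideal2_pred.

Lemma ideal2P z :
  reflect (exists s : seq (R * R), z = \sum_(u <- s) u.1 * r * u.2)
          (z \in ideal2).
Proof. exact: asboolP. Qed.

Fact ideal2_zmod_closed : zmod_closed ideal2.
Proof.
split=> [|x y /ideal2P[s ->] /ideal2P[t ->]]; apply/ideal2P.
  by exists [::]; rewrite big_nil.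
exists (s ++ [seq (- u.1, u.2) | u <- t]).
rewrite big_cat big_map -sumrN; congr (_ + _).
by apply: eq_bigr => u _; rewrite /= !mulNr.
Qed.

HB.instance Definition _ :=
  GRing.isZmodClosed.Build R ideal2_pred ideal2_zmod_closed.

Lemma ideal2Ml a z : z \in ideal2 -> a * z \in ideal2.
Proof.
case/ideal2P=> s ->; apply/ideal2P; exists [seq (a * u.1, u.2) | u <- s].
by rewrite big_map mulr_sumr; apply: eq_bigr => u _; rewrite /= !mulrA.
Qed.

Lemma ideal2Mr a z : z \in ideal2 -> z * a \in ideal2.
Proof.
case/ideal2P=> s ->; apply/ideal2P; exists [seq (u.1, u.2 * a) | u <- s].
by rewrite big_map mulr_suml; apply: eq_bigr => u _; rewrite /= !mulrA.
Qed.

Let I : zmodClosed R := GRing.ZmodClosed.clone R ideal2_pred _.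

Definition quot2 : Type := Quotient.quot I.
HB.instance Definition _ := GRing.Zmodule.copy quot2 (Quotient.quot I).

Definition quot2_pi (z : R) : quot2 := (\pi_(Quotient.quot I) z)%qT.

Lemma quot2_eq z w : (quot2_pi z = quot2_pi w) <-> z - w \in ideal2.
Proof.
rewrite (Quotient.idealrBE I).
by split=> [/eqP|/eqP].
Qed.

Definition quot2_repr (a : quot2) : R := (repr (a : Quotient.quot I))%qT.

Lemma quot2_reprK : cancel quot2_repr quot2_pi.
Proof. by move=> a; rewrite /quot2_pi /quot2_repr reprK. Qed.

Fact quot2_pi_is_zmod_morphism : zmod_morphism quot2_pi.
Proof. by move=> z w; rewrite /quot2_pi raddfB. Qed.

HB.instance Definition _ :=
  GRing.isZmodMorphism.Build R quot2 quot2_pi quot2_pi_is_zmod_morphism.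

Definition quot2_one : quot2 := quot2_pi 1.
Definition quot2_mul (a b : quot2) : quot2 :=
  quot2_pi (quot2_repr a * quot2_repr b).

Fact quot2_piM : {morph quot2_pi : z w / z * w >-> quot2_mul z w}.
Proof.
move=> z w; apply/quot2_eq.
set z' := quot2_repr _; set w' := quot2_repr _.
have hz : z - z' \in ideal2 by apply/quot2_eq; rewrite quot2_reprK.
have hw : w - w' \in ideal2 by apply/quot2_eq; rewrite quot2_reprK.
have -> : z * w - z' * w' = (z - z') * w + z' * (w - w').
  by rewrite mulrBl mulrBr addrA subrK.
by apply: rpredD; [exact: ideal2Mr | exact: ideal2Ml].
Qed.

Fact quot2_mulA : associative quot2_mul.
Proof.
move=> a b c; rewrite -(quot2_reprK a) -(quot2_reprK b) -(quot2_reprK c).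
by rewrite -!quot2_piM mulrA.
Qed.

Fact quot2_mul1r : left_id quot2_one quot2_mul.
Proof.
by move=> a; rewrite -(quot2_reprK a) /quot2_one -quot2_piM mul1r.
Qed.

Fact quot2_mulr1 : right_id quot2_one quot2_mul.
Proof.
by move=> a; rewrite -(quot2_reprK a) /quot2_one -quot2_piM mulr1.
Qed.

Fact quot2_mulDl : left_distributive quot2_mul +%R.
Proof.
move=> a b c; rewrite -(quot2_reprK a) -(quot2_reprK b) -(quot2_reprK c).
by rewrite -raddfD -!quot2_piM mulrDl raddfD.
Qed.

Fact quot2_mulDr : right_distributive quot2_mul +%R.
Proof.
move=> a b c; rewrite -(quot2_reprK a) -(quot2_reprK b) -(quot2_reprK c).
by rewrite -raddfD -!quot2_piM mulrDr raddfD.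
Qed.

HB.instance Definition _ := GRing.Zmodule_isPzRing.Build quot2
  quot2_mulA quot2_mul1r quot2_mulr1 quot2_mulDl quot2_mulDr.

Fact quot2_pi_is_monoid_morphism : monoid_morphism quot2_pi.
Proof. by split; [|exact: quot2_piM]. Qed.

HB.instance Definition _ :=
  GRing.isMonoidMorphism.Build R quot2 quot2_pi quot2_pi_is_monoid_morphism.

Lemma quot2_gen : quot2_pi r = 0.
Proof.
rewrite -(raddf0 quot2_pi); apply/quot2_eq/ideal2P; exists [:: (1, 1)].
by rewrite big_seq1 mul1r mulr1 subr0.
Qed.

End PrincipalQuotient.

Section Center.
Variable R : pzRingType.

Definition central_pred (z : R) : bool := `[< forall a, z * a = a * z >].
Definition central : {pred R} := central_pred.

Lemma centralP z : reflect (forall a, z * a = a * z) (z \in central).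
Proof. exact: asboolP. Qed.

Fact central_subring_closed : subring_closed central.
Proof.
split=> [|x y /centralP cx /centralP cy|x y /centralP cx /centralP cy];
  apply/centralP => a.
- by rewrite mul1r mulr1.
- by rewrite mulrBl mulrBr cx cy.
- by rewrite -mulrA cy mulrA cx mulrA.
Qed.

HB.instance Definition _ :=
  GRing.isSubringClosed.Build R central_pred central_subring_closed.

Record center : predArgType :=
  Center { center_val :> R; _ : central_pred center_val }.

HB.instance Definition _ := [isSub for center_val].
HB.instance Definition _ := [Choice of center by <:].
HB.instance Definition _ :=
  GRing.SubChoice_isSubPzRing.Build R central_pred center central_subring_closed.

Fact center_mulC : @commutative center center *%R.
Proof.
by move=> x y; apply: val_inj; rewrite !rmorphM /=; case: x => x /= /centralP.
Qed.

HB.instance Definition _ :=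
  GRing.PzRing_hasCommutativeMul.Build center center_mulC.

End Center.

                                           
Section QWeyl.
Variables (R : comNzRingType) (q : R).

                                                                             
                            
Definition free2 : Type := {malg R[{fmonom bool}]}.
HB.instance Definition _ := GRing.Lalgebra.on free2.

Definition free_x : free2 := << fmu true >>.
Definition free_y : free2 := << fmu false >>.

Definition qweyl_rel : free2 := free_x * free_y - q *: (free_y * free_x) - 1.

Definition qweyl : Type := quot2 qweyl_rel.
HB.instance Definition _ := GRing.PzRing.on qweyl.

Definition qweyl_pi : {rmorphism free2 -> qweyl} := @quot2_pi _ qweyl_rel.
Definition qweyl_const (a : R) : qweyl := qweyl_pi a%:A.
Definition qweyl_x : qweyl := qweyl_pi free_x.
Definition qweyl_y : qweyl := qweyl_pi free_y.

Lemma qweyl_relation :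
  qweyl_x * qweyl_y = qweyl_const q * qweyl_y * qweyl_x + 1.
Proof.
have: qweyl_pi qweyl_rel = 0 by exact: quot2_gen.
rewrite /qweyl_rel !rmorphB rmorph1 rmorphM -mulr_algl !rmorphM => /eqP.
by rewrite subr_eq0 subr_eq => /eqP ->; rewrite addrC !mulrA.
Qed.

                                                                        
                                                 
Definition eval_powers (n : nat) (f : {poly {poly R}}) : qweyl :=
  \sum_(i < size f) \sum_(j < size f`_i)
    qweyl_const f`_i`_j * (qweyl_x ^+ n) ^+ i * (qweyl_y ^+ n) ^+ j.

End QWeyl.

Section Zrho.
Variable p : nat.

                           
Definition cyclo_prime : {poly int} := \poly_(i < p) 1.

                                                                        
                                
Lemma mk_monic_cyclo_prime : (1 < p)%N -> mk_monic cyclo_prime = cyclo_prime.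
Proof.
move=> p_gt1; have p_gt0 := ltnW p_gt1; rewrite /mk_monic /cyclo_prime.
rewrite size_poly_eq ?oner_eq0 // p_gt1 /= monicE.
by rewrite lead_coef_poly // eqxx.
Qed.

Definition Zrho : Type := {poly %/ cyclo_prime}.
HB.instance Definition _ := GRing.ComNzRing.on Zrho.

Definition rho : Zrho := 'qX.

Definition B : Type := qweyl rho.
HB.instance Definition _ := GRing.PzRing.on B.

End Zrho.

Section Orders.
Variables (C : comPzRingType) (K : fieldType) (iota : {rmorphism C -> K}).

Definition is_fraction_field : Prop :=
  injective iota /\
  (forall k : K, exists a b : C, iota b != 0 /\ k = iota a / iota b).

Section Algebra.
Variable A : algType K.

Definition central_simple : Prop :=
  [/\ exists n (e : 'I_n -> A), forall a : A,
        exists k : 'I_n -> K, a = \sum_i k i *: e i,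
      forall z : A, (forall a, z * a = a * z) <-> (exists k : K, z = k%:A)
    & forall I : {pred A}, zmod_closed I ->
        (forall a u : A, u \in I -> a * u \in I /\ u * a \in I) ->
        (forall u, u \in I -> u = 0) \/ (forall u, u \in I)].

                                                                           
                                  
Definition is_order (L : {pred A}) : Prop :=
  [/\ subring_closed L,
      exists n (e : 'I_n -> A), forall a : A,
        a \in L <-> exists c : 'I_n -> C, a = \sum_i iota (c i) *: e i
    & forall a : A, exists n (k : 'I_n -> K) (l : 'I_n -> A),
        (forall i, l i \in L) /\ a = \sum_i k i *: l i].

Definition is_maximal_order (L : {pred A}) : Prop :=
  is_order L /\
  forall L' : {pred A}, is_order L' -> {subset L <= L'} -> L =i L'.

End Algebra.

End Orders.

Section ScalarExtension.
Variables (R : pzRingType) (K : fieldType).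
Variables (iota : {rmorphism center R -> K}) (A : algType K).

                                                                               
                                                                            
                                                      
Definition is_tensor_algebra (j : {rmorphism R -> A}) : Prop :=
  (forall c : center R, j (val c) = (iota c)%:A) /\
  (forall (V : lmodType K) (f : {additive R -> V}),
     (forall (c : center R) (b : R), f (val c * b) = iota c *: f b) ->
     exists g : {linear A -> V},
       (forall b, g (j b) = f b) /\
       (forall g' : {linear A -> V}, (forall b, g' (j b) = f b) -> g' =1 g)).

Definition image_pred (j : R -> A) : {pred A} :=
  fun a : A => `[< exists b, j b = a >].

End ScalarExtension.

(* Main.v *)
(* An element of a larger order has the form b/d with d the (central) conductor,
   so d b^k lies in d^k B for all k. Order the monomials y^i x^j of the q-Weyl
   algebra B lexicographically. Leading monomials are multiplicative up to powers
   of the unit q: hence B is a domain, the leading exponents of b dominate those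
   of d, and, Z[rho] being completely integrally closed, the leading coefficient
   of d divides that of b. Subtracting from b/d the corresponding monomial of B
   stays in the larger order and lowers the leading monomial of b, so b/d is in B
   by induction. The center is found by a similar descent: the leading monomial
   of a central element is c y^i x^j with p dividing i and j.
   That Z[rho] is a domain and is completely integrally closed is checked one
   prime l at a time: for l <> p some power of the Frobenius is the identity
   modulo l, and p is, up to a factor prime to rho - 1, a power of the prime
   element rho - 1. *)
Require Import Defs.
From HB Require Import structures.
From mathcomp Require Import all_boot all_order all_algebra.
From mathcomp Require Import cyclic qpoly.
From mathcomp.multinomials Require Import monalg.
From mathcomp.classical Require Import boolp.
From mathcomp Require Import zify ring.

Set Implicit Arguments.
Unset Strict Implicit.
Unset Printing Implicit Defensive.

Import GRing.Theory.
Local Open Scope ring_scope.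

(** * Cyclotomic integers *)

(** Leading terms make sense only once the monomials y^i x^j are known to be independent, and B is
    given merely as a quotient of a free algebra. Independence comes from letting that algebra act
    on Z[rho][y][x], with x acting through the q-derivative; the action on 1 recovers the normal
    form. The conductor exists because B is free over C on the y^i x^j with i, j < p: this gives
    coordinates on A, and the finitely many generators of an order have a common denominator in C.
    Passing to leading coefficients, d b^k in d^k B becomes exactly the hypothesis of complete
    integral closedness. Since b/d need not lie in B, the descent is phrased for numerators b,
    through a predicate M stable under b -> b - d s. Simplicity of A holds because a domain of
    finite dimension over K is a division ring. In Z[rho], put pi = rho - 1. Evaluation at X = 1
    shows that pi is prime with residue field F_p, and no nonzero element is divisible by all powers
    of pi; these two facts already make Z[rho] a domain. *)

Section Frobenius.
Variable l : nat.
Hypothesis l_prime : prime l.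

Lemma exprD_prime (S : comNzRingType) (a b : S) :
  exists h, (a + b) ^+ l = a ^+ l + b ^+ l + l%:R * h.
Proof.
have l_gt0 := prime_gt0 l_prime.
rewrite exprDn -(prednK l_gt0) big_ord_recl big_ord_recr /= !prednK //.
rewrite subn0 expr0 mulr1 bin0 /bump leq0n add1n prednK // subnn mul1r binn !mulr1n.
exists (\sum_(i < l.-1) (a ^+ (l - i.+1) * b ^+ i.+1) *+ ('C(l, i.+1) %/ l)).
rewrite addrA addrAC; congr (_ + _); rewrite mulr_sumr; apply: eq_bigr => i _.
rewrite mulr_natl -mulrnA divnK // prime_dvd_bin //=.
by have := ltn_ord i; lia.
Qed.

(** Follows from the additive congruence for a + (- a) = 0, which treats l = 2 together with the odd
    primes. *)
Lemma exprN_prime (S : comNzRingType) (a : S) :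
  exists h, (- a) ^+ l = - a ^+ l + l%:R * h.
Proof.
have [h] := exprD_prime a (- a); rewrite subrr expr0n.
rewrite (gtn_eqF (prime_gt0 l_prime)) /= => e; exists (- h).
apply/eqP; rewrite -subr_eq0; apply/eqP; rewrite [RHS]e.
by move: (_ ^+ l) (_ ^+ l) => u v; ring.
Qed.

Lemma fermat_int (c : int) : exists h, c ^+ l = c + l%:R * h.
Proof.
have hn (m : nat) : exists h, (m%:R : int) ^+ l = m%:R + l%:R * h.
  elim: m => [|m [h IH]].
    by exists 0; rewrite expr0n (gtn_eqF (prime_gt0 l_prime)) mulr0 addr0.
  have [h' e] := exprD_prime (m%:R : int) 1.
  by exists (h + h'); rewrite -natr1 e IH expr1n mulrDr -!addrA; congr (_ + _); rewrite addrCA.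
case: c => m; first by have [h e] := hn m; exists h; rewrite -[Posz m]natz.
have [h e] := hn m.+1; have [h' e'] := exprN_prime (m.+1%:R : int).
exists (h' - h); rewrite NegzE -[Posz m.+1]natz e' e.
by rewrite mulrBr opprD -addrA [- _ + _ * _]addrC.
Qed.

Lemma poly_frobenius (f : {poly int}) :
  exists h, f ^+ l = f \Po 'X^l + l%:R * h.
Proof.
elim/poly_ind: f => [|f c [h IH]].
  by exists 0; rewrite expr0n (gtn_eqF (prime_gt0 l_prime)) comp_poly0 mulr0 addr0.
have [h1 ->] := exprD_prime (f * 'X) c%:P; have [k hk] := fermat_int c.
exists (h * 'X^l + k%:P + h1).
rewrite exprMn IH comp_polyD comp_polyM comp_polyX comp_polyC -polyC_exp hk.
by rewrite polyCD polyCM -[l%:R in LHS]polyC_natr; ring.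
Qed.

Lemma poly_frobenius_iter (f : {poly int}) e :
  exists h, f ^+ (l ^ e) = f \Po 'X^(l ^ e) + l%:R * h.
Proof.
elim: e => [|e [h IH]].
  by exists 0; rewrite expn0 !expr1 comp_polyXr mulr0 addr0.
have [h1 e1] := exprD_prime (f \Po 'X^(l ^ e)) (l%:R * h).
have [h2 e2] := poly_frobenius (f \Po 'X^(l ^ e)).
exists (h2 + l%:R ^+ l.-1 * h ^+ l + h1).
have hl : l%:R ^+ l = l%:R * l%:R ^+ l.-1 :> {poly int}.
  by rewrite -exprS (prednK (prime_gt0 l_prime)).
rewrite expnSr exprM IH e1 e2 -comp_polyA comp_Xn_poly -exprM [(l * _)%N]mulnC.
by rewrite [(_ * h) ^+ l]exprMn hl !mulrDr !mulrA !addrA.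
Qed.

End Frobenius.

(** A fraction-free form: u is a common denominator of all powers of b/g, and the conclusion is that
    b/g lies in R. *)
Definition completely_integrally_closed (R : comNzRingType) : Prop :=
  forall u b g : R, u != 0 -> g != 0 ->
    (forall k, exists v, u * b ^+ k = g ^+ k * v) -> exists s, b = g * s.

(** * Z[rho] through its presentation by Z[X]: the prime rho - 1, the domain property, complete
    integral closedness *)

Section CyclotomicIntegers.
Import Num.Theory.
Variables (p : nat) (R : comNzRingType) (phi : {rmorphism {poly int} -> R}).
Hypothesis p_prime : prime p.
Implicit Types (f g h : {poly int}) (a b z w : R).
Local Notation Phi := (cyclo_prime p).
Hypothesis phi_ker : forall f, phi f = 0 <-> exists g, f = g * Phi.
Hypothesis phi_surj : forall z, exists2 f : {poly int}, (size f < p)%N & phi f = z.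

Let p_gt0 := prime_gt0 p_prime.
Let p_gt1 := prime_gt1 p_prime.

Local Notation pi := (phi ('X - 1)).

Definition dvdr (a b : R) := exists c, b = a * c.

Lemma size_cyclo_prime : size Phi = p.
Proof. by rewrite size_poly_eq // oner_eq0. Qed.

Lemma cyclo_prime_neq0 : Phi != 0.
Proof. by rewrite -size_poly_gt0 size_cyclo_prime. Qed.

Lemma cyclo_prime1 : Phi.[1] = p%:R.
Proof.
rewrite horner_poly (eq_bigr (fun=> 1)) => [|i _]; last by rewrite expr1n mulr1.
by rewrite sumr_const card_ord.
Qed.

Lemma cyclo_primeM : ('X - 1) * Phi = 'X^p - 1.
Proof.
rewrite subrX1 /cyclo_prime poly_def; congr (_ * _).
by apply: eq_bigr => i _; rewrite scale1r.
Qed.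

Lemma phi_small f : (size f < p)%N -> phi f = 0 -> f = 0.
Proof.
move=> lt_f /phi_ker[g fE]; have [g0|g0] := eqVneq g 0; first by rewrite fE g0 mul0r.
move: lt_f; rewrite fE size_mul ?cyclo_prime_neq0 // size_cyclo_prime ltnNge.
have : (0 < size g)%N by rewrite size_poly_gt0.
by case: (size g) => // k _; rewrite addSn /= leq_addl.
Qed.

Lemma phi_eq f g : (size f < p)%N -> (size g < p)%N -> phi f = phi g -> f = g.
Proof.
move=> lt_f lt_g h; apply/eqP; rewrite -subr_eq0; apply/eqP/phi_small.
  by rewrite (leq_ltn_trans (size_polyD _ _)) // size_polyN gtn_max lt_f.
by rewrite rmorphB h subrr.
Qed.

Lemma size_natM m (f : {poly int}) : (size (m%:R * f)%R <= size f)%N.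
Proof. by rewrite -polyC_natr mul_polyC size_scale_leq. Qed.

Lemma phi_natr m : phi m%:R = m%:R.
Proof. exact: rmorph_nat. Qed.

Lemma cyclo_natrI m z : (0 < m)%N -> m%:R * z = 0 :> R -> z = 0.
Proof.
move=> m0; have [f lt_f <-] := phi_surj z.
rewrite -phi_natr -rmorphM => /phi_small; rewrite (leq_ltn_trans (size_natM _ _)) //.
move=> /(_ isT)/eqP; rewrite mulf_eq0 -polyC_natr polyC_eq0 pnatr_eq0.
by rewrite (gtn_eqF m0) => /eqP ->; rewrite rmorph0.
Qed.

(** A nonzero coefficient of the reduced representative, of absolute value m, would be divisible by
    l^m > m. *)
Lemma cyclo_natr_separated l z : (1 < l)%N ->
  (forall k, dvdr (l%:R ^+ k) z) -> z = 0.
Proof.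
move=> l_gt1; have [f lt_f <-] := phi_surj z => h.
suff -> : f = 0 by rewrite rmorph0.
apply/polyP=> i; rewrite coef0; apply/eqP; apply: contraT => fi0.
set m := absz f`_i; have [w hw] := h m; have [g lt_g gw] := phi_surj w.
have fE : f = (l ^ m)%N%:R * g.
  apply: phi_eq => //; first exact: leq_ltn_trans (size_natM _ _) _.
  by rewrite hw rmorphM gw phi_natr natrX.
have fiE : f`_i = (l ^ m)%N%:R * g`_i by rewrite {1}fE -polyC_natr coefCM.
have mE : m = (l ^ m * absz (g`_i)%R)%N.
  by rewrite -[LHS]/(absz f`_i) fiE abszM natz absz_nat.
have : (l ^ m <= m)%N.
  rewrite [X in (_ <= X)%N]mE leq_pmulr // absz_gt0.
  by apply: contra fi0 => /eqP g0; rewrite fiE g0 mulr0.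
by rewrite leqNgt ltn_expl.
Qed.

Lemma hornerX1 : ('X - 1 : {poly int}).[1] = 0.
Proof. by rewrite hornerD hornerN hornerX hornerC subrr. Qed.

(** Evaluation at 1 identifies the quotient by pi with the integers modulo p, because Phi(1) = p. *)
Lemma pi_dvdP f : dvdr pi (phi f) <-> (p %| f.[1])%Z.
Proof.
split=> [[w hw]|/dvdzP[k fk]].
  have [h _ hE] := phi_surj w.
  have /phi_ker[g gE] : phi (f - ('X - 1) * h) = 0.
    by rewrite rmorphB rmorphM hE hw subrr.
  apply/dvdzP; exists g.[1].
  have := congr1 (horner^~ 1) gE; rewrite /= hornerD hornerN 2!hornerM hornerX1 mul0r subr0 => ->.
  by rewrite cyclo_prime1 natz.
have /factor_theorem[h hE] : root (f - k%:P * Phi) 1.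
  by rewrite /root hornerD hornerN hornerM hornerC cyclo_prime1 fk natz subrr.
exists (phi h).
have -> : f = h * ('X - 1) + k%:P * Phi by rewrite -hE subrK.
have hz : phi (k%:P * Phi) = 0 by apply/phi_ker; exists k%:P.
by rewrite rmorphD hz addr0 rmorphM mulrC.
Qed.

Lemma pi_dvd_prime : dvdr pi p%:R.
Proof. by rewrite -phi_natr; apply/pi_dvdP; rewrite hornerMn hornerC natz dvdzz. Qed.

Lemma pi_prime a b : dvdr pi (a * b) -> dvdr pi a \/ dvdr pi b.
Proof.
have [f _ <-] := phi_surj a; have [g _ <-] := phi_surj b.
rewrite -rmorphM => /pi_dvdP; rewrite hornerM dvdzE abszM Euclid_dvdM //.
by case/orP=> h; [left|right]; apply/pi_dvdP.
Qed.

Lemma pi_dvdX a k : dvdr pi (a ^+ k) -> dvdr pi a.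
Proof.
elim: k => [|k IH]; last by rewrite exprS => /pi_prime[].
(* For exponent 0 the hypothesis makes pi a unit, which divides everything. *)
rewrite expr0 => -[c hc]; exists (c * a); by rewrite mulrA -hc mul1r.
Qed.

(** Dividing (X - 1)^p = X^p - 1 + p(...) by X - 1 gives (X - 1)^(p-1) = Phi + p k; at X = 1 this
    reads 0 = p + p k(1), so k(1) = -1 is prime to p. *)
Lemma pi_ramified : exists2 kappa, ~ dvdr pi kappa & pi ^+ p.-1 = p%:R * kappa.
Proof.
have [h hE] := exprD_prime p_prime ('X : {poly int}) (- 1).
have [t tE] := exprN_prime p_prime (1 : {poly int}).
have {}hE : ('X - 1) ^+ p = ('X - 1) * Phi + p%:R * (t + h).
  by rewrite cyclo_primeM hE tE expr1n; ring.
(* Every other term of [hE] vanishes at 1, so the cofactor of p is divisible by X - 1. *)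
have /factor_theorem[k kE] : root (t + h) 1.
  have := congr1 (horner^~ 1) hE.
  rewrite /= hornerD !hornerM horner_exp hornerX1 expr0n (gtn_eqF p_gt0) mul0r add0r.
  rewrite -polyC_natr hornerC => /esym/eqP; rewrite mulf_eq0 pnatr_eq0.
  by rewrite (gtn_eqF p_gt0).
rewrite polyC1 in kE.
have {}hE : ('X - 1) ^+ p.-1 = Phi + p%:R * k.
  have X1 : 'X - 1 != 0 :> {poly int} by rewrite -polyC1 polyXsubC_eq0.
  apply: (mulfI X1); rewrite -exprS prednK // hE kE; ring.
have k1 : k.[1] = -1.
  have := congr1 (horner^~ 1) hE; rewrite /= hornerD hornerM horner_exp hornerX1.
  rewrite expr0n -subn1 subn_eq0 leqNgt p_gt1 /= cyclo_prime1 -polyC_natr hornerC.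
  rewrite -[X in X + _]mulr1 -mulrDr => /esym/eqP; rewrite mulf_eq0 pnatr_eq0.
  by rewrite (gtn_eqF p_gt0) addrC addr_eq0 => /eqP.
exists (phi k).
  move/pi_dvdP; rewrite k1 dvdzE /= dvdn1 => /eqP p1.
  by have := p_gt1; rewrite p1.
have hz : phi Phi = 0 by apply/phi_ker; exists 1; rewrite mul1r.
by rewrite -rmorphXn hE rmorphD hz add0r rmorphM phi_natr.
Qed.

(** pi divides p, and multiplication by p is injective on reduced representatives; the domain
    property is not yet available here. *)
Lemma pi_mulI z : pi * z = 0 -> z = 0.
Proof.
move=> pz0; apply: (cyclo_natrI p_gt0).
by have [c ->] := pi_dvd_prime; rewrite mulrAC pz0 mul0r.
Qed.

Lemma piX_mulI k z : pi ^+ k * z = 0 -> z = 0.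
Proof.
by elim: k => [|k IH]; rewrite ?expr0 ?mul1r // exprS -mulrA => /pi_mulI.
Qed.

Lemma dvdr_prime_piX k : dvdr (p%:R ^+ k) (pi ^+ (p.-1 * k)).
Proof.
have [kappa _ hk] := pi_ramified; exists (kappa ^+ k).
by rewrite exprM hk exprMn.
Qed.

(** Otherwise all powers of pi, hence all powers of p, would divide z. *)
Lemma pi_decomposition z : z != 0 -> exists i w, z = pi ^+ i * w /\ ~ dvdr pi w.
Proof.
move=> z0; have [//|h] := pselect (exists i w, z = pi ^+ i * w /\ ~ dvdr pi w).
have hd k : dvdr (pi ^+ k) z.
  elim: k => [|k [c hc]]; first by exists z; rewrite expr0 mul1r.
  have [[d hd]|nd] := pselect (dvdr pi c); last by case: h; exists k, c.
  by exists d; rewrite hc hd exprSr mulrA.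
case/eqP: z0; apply: (cyclo_natr_separated p_gt1) => k.
have [c ->] := hd (p.-1 * k)%N; have [d ->] := dvdr_prime_piX k.
by exists (d * c); rewrite mulrA.
Qed.

(** After cancelling powers of pi, the pi-free parts of a and b would have product 0, which the
    prime pi divides. *)
Lemma cyclo_domain a b : a * b = 0 -> a = 0 \/ b = 0.
Proof.
move=> ab0; have [->|a0] := eqVneq a 0; first by left.
have [->|b0] := eqVneq b 0; first by right.
have [i [a' [aE na]]] := pi_decomposition a0.
have [j [b' [bE nb]]] := pi_decomposition b0.
have : dvdr pi (a' * b').
  exists 0; rewrite mulr0; apply: (@piX_mulI (i + j)).
  by rewrite exprD mulrACA -aE -bE.
by case/pi_prime.
Qed.

Lemma cyclo_mulI a b c : a != 0 -> a * b = a * c -> b = c.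
Proof.
move=> a0 h; apply/eqP; rewrite -subr_eq0; apply/eqP.
have /cyclo_domain[a00|//] : a * (b - c) = 0 by rewrite mulrBr h subrr.
by rewrite a00 eqxx in a0.
Qed.

Lemma cyclo_natr_neq0 m : (0 < m)%N -> m%:R != 0 :> R.
Proof.
move=> m0; apply/eqP=> h; have := @cyclo_natrI m 1 m0.
by rewrite h mul0r => /(_ erefl)/eqP; rewrite oner_eq0.
Qed.

Lemma root_prime_expr : phi 'X ^+ p = 1.
Proof.
apply/eqP; rewrite -subr_eq0 -rmorphXn -(rmorph1 phi) -rmorphB -cyclo_primeM.
by apply/eqP/phi_ker; exists ('X - 1).
Qed.

Lemma root_primitive : p.-primitive_root (phi 'X).
Proof.
have [m pm] := prim_order_exists p_gt0 root_prime_expr.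
have [_ hp] := primeP p_prime; case/hp/orP=> /eqP mE; last by rewrite -mE.
have := prim_expr_order pm; rewrite mE expr1 => X1.
have [c] := pi_dvd_prime; rewrite rmorphB rmorph1 X1 subrr mul0r => /eqP.
by rewrite (negPf (cyclo_natr_neq0 p_gt0)).
Qed.

(* Pseudo-division of Phi by f lowers the degree until a constant is reached. *)
Lemma cyclo_norm z : z != 0 -> exists w m, (0 < m)%N /\ z * w = m%:R.
Proof.
have [f lt_f <-] := phi_surj z; clear z; move: lt_f.
have [N le_N] := ubnP (size f); elim: N => // N IH in f le_N * => lt_f f0.
have f0' : f != 0 by apply: contra f0 => /eqP ->; rewrite rmorph0.
have [/size1_polyC fC|f_gt1] := leqP (size f) 1.
  have c0 : f`_0 != 0 by apply: contra f0' => /eqP c0; rewrite fC c0.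
  exists (phi (Num.sg f`_0)%:P), (absz f`_0); rewrite absz_gt0 c0; split=> //.
  rewrite fC -rmorphM -polyCM mulrC coefC /= -normrEsg -phi_natr -polyC_natr natz.
  by rewrite abszE.
have := Pdiv.Idomain.divp_eq Phi f; have := ltn_modp Phi f; rewrite f0'.
have : lead_coef f ^+ scalp Phi f != 0 by rewrite expf_neq0 // lead_coef_eq0.
move: (_ ^+ _) (Phi %/ f) (Phi %% f) => l a r l0 lt_r hE.
have hphi : phi r = - (phi a * phi f).
  apply/eqP; rewrite -addr_eq0 addrC -rmorphM -rmorphD -hE; apply/eqP/phi_ker.
  by exists l%:P; rewrite mul_polyC.
have [r0|r0] := eqVneq (phi r) 0; last first.
  have [w [m [m0 hm]]] := IH r (leq_trans lt_r le_N) (ltn_trans lt_r lt_f) r0.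
  by exists (- phi a * w), m; split=> //; rewrite -hm hphi; ring.
have rE : r = 0 by apply: phi_small r0; exact: ltn_trans lt_r lt_f.
move: hphi; rewrite r0 => /esym/eqP; rewrite oppr_eq0 => /eqP /cyclo_domain[|f00]; last first.
  by rewrite f00 eqxx in f0.
(* A zero remainder would make f, of positive degree, divide the nonzero constant l; degrees forbid
   this. *)
move=> /phi_ker[g aE]; have hl : l%:P = g * f.
  apply: (mulIf cyclo_prime_neq0); rewrite mul_polyC hE rE addr0 aE; ring.
have g0 : g != 0 by apply: contra l0 => /eqP g0; rewrite -polyC_eq0 hl g0 mul0r.
have := congr1 (fun h : {poly int} => size h) hl; rewrite /= size_mul // size_polyC l0.
have : (0 < size g)%N by rewrite size_poly_gt0.
by move: f_gt1; move: (size g) (size f) => i k; lia.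
Qed.

(* If b were exactly divisible by pi^a with a < p - 1, comparing the exponents of
   pi for large n would force pi to divide the pi-free part of u, b or kappa. *)
Lemma cic_ramified u b : u != 0 ->
  (forall n, dvdr (p%:R ^+ n) (u * b ^+ n)) -> dvdr p%:R b.
Proof.
move=> u0 h; have [kappa nk hk] := pi_ramified.
suff hd (a : nat) : (a <= p.-1)%N -> dvdr (pi ^+ a) b.
  by have [c ->] := hd _ (leqnn _); exists (kappa * c); rewrite hk mulrA.
elim: a => [|a IH] lt_a; first by exists b; rewrite expr0 mul1r.
have [c bE] := IH (ltnW lt_a).
have [[d cE]|nc] := pselect (dvdr pi c).
  by exists d; rewrite bE cE exprSr mulrA.
have [i [v [uE nv]]] := pi_decomposition u0.
(* With n = i + 1 and a < p - 1 one has (p - 1) n >= i + a n + 1: a factor pi survives the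
   cancellation of pi^(i + a n). *)
have [z hz] := h i.+1; exfalso.
have /pi_prime[/pi_prime[/pi_dvdX|]|/pi_dvdX] // : dvdr pi (kappa ^+ i.+1 * v * c ^+ i.+1).
exists (pi ^+ ((p.-1 - a) * i.+1 - i.+1) * z).
apply/eqP; rewrite -subr_eq0; apply/eqP; apply: (@piX_mulI (i + a * i.+1)).
rewrite mulrBr; apply/eqP; rewrite subr_eq0; apply/eqP.
transitivity (kappa ^+ i.+1 * (u * b ^+ i.+1)).
  by rewrite uE bE exprMn -exprM exprD; ring.
rewrite hz !mulrA -exprMn [kappa * _]mulrC -hk -exprM -exprSr -exprD; congr (pi ^+ _ * z).
by nia.
Qed.

Lemma phi_comp f g h : phi g = phi h -> phi (f \Po g) = phi (f \Po h).
Proof.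
move=> gh; elim/poly_ind: f => [|f c IH]; first by rewrite !comp_poly0.
by rewrite !comp_polyD !comp_polyM !comp_polyX !comp_polyC !rmorphD !rmorphM IH gh.
Qed.

(* A power of l is 1 modulo p, so the corresponding power of the Frobenius fixes
   rho and hence every b modulo l. *)
Lemma cic_unramified l m b : prime l -> l != p -> (0 < m)%N ->
  (forall n, dvdr (l%:R ^+ n) (m%:R * b ^+ n)) -> dvdr l%:R b.
Proof.
move=> l_prime lp m0 h.
have l_gt0 := prime_gt0 l_prime.
have [m' co mE] := pfactor_coprime l_prime m0; set k := logn l m in mE.
(* The exponent k + 1 leaves one factor l after cancelling the l-part l^k of m. *)
have [z hz] : dvdr l%:R (m'%:R * b ^+ k.+1).
  have [z hz] := h k.+1; exists z.
  apply: (@cyclo_mulI (l ^ k)%N%:R); first by rewrite cyclo_natr_neq0 ?expn_gt0 ?l_gt0.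
  by rewrite mulrA -natrM mulnC -mE hz natrX mulrA -exprSr.
have [w hw] : dvdr l%:R (b ^+ k.+1).
  (* m' is invertible modulo l, since 1 + a m' = c l. *)
  have [a _] := Bezoutl m' l_gt0; rewrite (eqP co) => /dvdnP[c hc].
  exists (c%:R * b ^+ k.+1 - a%:R * z).
  have := congr1 (fun n : nat => n%:R * b ^+ k.+1) hc; rewrite /= natrD !natrM.
  rewrite mulrDl mul1r -[a%:R * _ * _]mulrA hz => hb.
  by rewrite mulrBr mulrA [l%:R * _]mulrC -hb; ring.
(* A multiple of p - 1, so that l^e = 1 modulo p, and large enough for l^e >= k + 1: then b =
   b^(l^e) = 0 modulo l. *)
pose e := (p.-1 * k.+1)%N.
have [f _ fE] := phi_surj b.
have [t tE] := poly_frobenius_iter l_prime f e.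
have phiX : phi 'X^(l ^ e) = phi 'X.
  rewrite rmorphXn -(expr_mod _ root_prime_expr) /e expnM -modnXm.
  rewrite -(totient_prime p_prime) Euler_exp_totient; last first.
    by rewrite coprime_sym prime_coprime // dvdn_prime2 // eq_sym.
  by rewrite modnXm exp1n modn_small // expr1.
have le_e : (k.+1 <= l ^ e)%N.
  apply: leq_trans (ltnW (ltn_expl e (prime_gt1 l_prime))).
  by rewrite leq_pmull // -ltnS prednK.
exists (w * b ^+ (l ^ e - k.+1) - phi t).
rewrite mulrBr mulrA -hw -exprD subnKC // -fE -rmorphXn tE rmorphD rmorphM phi_natr.
by rewrite addrK (phi_comp f phiX) comp_polyXr.
Qed.

(** One prime factor l of N = N' l is removed at a time: b = N' c by induction, and cancelling
    powers of N' transfers the hypothesis to c and l. *)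
Lemma cic_natr m b N : (0 < m)%N -> (0 < N)%N ->
  (forall n, dvdr (N%:R ^+ n) (m%:R * b ^+ n)) -> dvdr N%:R b.
Proof.
move=> m0; elim/ltn_ind: N b => N IH b N0 h.
have [N1|N1] := leqP N 1.
  have -> : N = 1%N by apply/eqP; rewrite eqn_leq N1.
  by exists b; rewrite mul1r.
have l_prime := pdiv_prime N1; set l := pdiv N in l_prime.
have NE : (N = N %/ l * l)%N by rewrite divnK // pdiv_dvd.
move: (N %/ l)%N NE => N' NE.
have N'0 : (0 < N')%N by move: N0; rewrite NE muln_gt0 => /andP[].
have [|//|n|c bE] := IH N' _ b.
- by rewrite NE ltn_Pmulr // prime_gt1.
- have [v ->] := h n; exists (l%:R ^+ n * v).
  by rewrite NE natrM exprMn mulrA.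
have hc n : dvdr (l%:R ^+ n) (m%:R * c ^+ n).
  have [v hv] := h n; exists v; apply: (@cyclo_mulI (N'%:R ^+ n)).
    by rewrite -natrX cyclo_natr_neq0 // expn_gt0 N'0.
  by rewrite [RHS]mulrA -exprMn -natrM -NE -hv bE exprMn mulrCA.
have [d cE] : dvdr l%:R c.
  have [lp|lp] := eqVneq l p; last exact: cic_unramified hc.
  by rewrite lp in hc *; apply: cic_ramified hc; exact: cyclo_natr_neq0.
by exists d; rewrite bE cE NE natrM mulrA.
Qed.

(** Denominators are made integral: b/g = b g'/N with g g' = N, and u is replaced by its multiple m
    = u u'. *)
Lemma cyclo_completely_integrally_closed : completely_integrally_closed R.
Proof.
move=> u b g u0 g0 h.
have [u' [m [m0 uE]]] := cyclo_norm u0; have [g' [N [N0 gE]]] := cyclo_norm g0.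
have [s sE] : dvdr N%:R (b * g').
  apply: (cic_natr m0 N0) => n; have [v hv] := h n; exists (u' * v).
  rewrite -uE -gE !exprMn; transitivity (u' * g' ^+ n * (u * b ^+ n)); first by ring.
  by rewrite hv; ring.
have g'0 : g' != 0.
  by apply: contra (cyclo_natr_neq0 N0) => /eqP g'0; rewrite -gE g'0 mulr0.
by exists s; apply: (cyclo_mulI g'0); rewrite mulrC sE -gE; ring.
Qed.

End CyclotomicIntegers.

(** * Normal forms in the q-Weyl algebra *)

Section QWeylNormalForm.
Variables (R : idomainType) (q : R).

Local Notation P := {poly {poly R}}.
Local Notation W := (qweyl q).
Local Notation x := (qweyl_x q).
Local Notation y := (qweyl_y q).
Local Notation const := (@qweyl_const R q).

(** The q-integer [k]_q, for which D_q(y^k) = [k]_q y^(k-1). *)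
Definition qint (k : nat) : R := \sum_(i < k) q ^+ i.

Lemma qintS k : qint k.+1 = 1 + q * qint k.
Proof.
rewrite /qint big_ord_recl expr0 mulr_sumr; congr (_ + _).
by apply: eq_bigr => i _; rewrite exprS.
Qed.

Definition qshift (f : {poly R}) : {poly R} := \poly_(i < size f) (f`_i * q ^+ i).
Definition qderiv (f : {poly R}) : {poly R} :=
  \poly_(i < size f) (f`_i.+1 * qint i.+1).

Lemma coef_qshift f i : (qshift f)`_i = f`_i * q ^+ i.
Proof. by rewrite coef_poly; case: ltnP => // /(nth_default 0) ->; rewrite mul0r. Qed.

Lemma coef_qderiv f i : (qderiv f)`_i = f`_i.+1 * qint i.+1.
Proof.
rewrite coef_poly; case: ltnP => // le_fi.
by rewrite nth_default ?mul0r // ltnW.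
Qed.

Fact qshift_is_zmod_morphism : zmod_morphism qshift.
Proof. by move=> f g; apply/polyP=> i; rewrite !(coef_qshift, coefB) mulrBl. Qed.
HB.instance Definition _ :=
  GRing.isZmodMorphism.Build _ _ qshift qshift_is_zmod_morphism.

Fact qderiv_is_zmod_morphism : zmod_morphism qderiv.
Proof. by move=> f g; apply/polyP=> i; rewrite !(coef_qderiv, coefB) mulrBl. Qed.
HB.instance Definition _ :=
  GRing.isZmodMorphism.Build _ _ qderiv qderiv_is_zmod_morphism.

Lemma qshiftC c : qshift c%:P = c%:P.
Proof.
apply/polyP=> i; rewrite coef_qshift coefC.
by case: i => [|i]; rewrite /= ?mulr1 ?mul0r.
Qed.

Lemma qderivC c : qderiv c%:P = 0.
Proof. by apply/polyP=> i; rewrite coef_qderiv coefC mul0r coef0. Qed.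

Lemma qshiftMX f : qshift (f * 'X) = q%:P * qshift f * 'X.
Proof.
apply/polyP=> -[|i]; rewrite coef_qshift !coefMX /= ?mul0r // coefCM coef_qshift.
by rewrite exprS mulrCA.
Qed.

Lemma qderivMX f : qderiv (f * 'X) = q%:P * qderiv f * 'X + f.
Proof.
apply/polyP=> i; rewrite coefD coef_qderiv !coefMX /= qintS mulrDr mulr1 addrC.
case: i => [|i] /=; first by rewrite /qint big_ord0 !mulr0.
by rewrite coefCM coef_qderiv mulrCA.
Qed.

Lemma qshiftCM c f : qshift (c%:P * f) = c%:P * qshift f.
Proof. by apply/polyP=> i; rewrite coef_qshift !coefCM coef_qshift mulrA. Qed.

Lemma qderivCM c f : qderiv (c%:P * f) = c%:P * qderiv f.
Proof. by apply/polyP=> i; rewrite coef_qderiv !coefCM coef_qderiv mulrA. Qed.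

(* Left multiplication by x on normal forms sum_i f_i(y) x^i, from
   x f(y) = f(q y) x + (D_q f)(y) with D_q the q-derivative. *)
Definition xop (F : P) : P := map_poly qshift F * 'X + map_poly qderiv F.

Fact xop_is_zmod_morphism : zmod_morphism xop.
Proof. by move=> F G; rewrite /xop !raddfB /= mulrBl opprD addrACA. Qed.
HB.instance Definition _ := GRing.isZmodMorphism.Build _ _ xop xop_is_zmod_morphism.

Lemma xopMX F : xop (F * 'X) = xop F * 'X.
Proof.
suff h (g : {additive {poly R} -> {poly R}}) :
  map_poly g (F * 'X) = map_poly g F * 'X by rewrite /xop !h mulrDl.
apply/polyP=> i; rewrite coef_map !coefMX; case: i => [|i] /=; first exact: raddf0.
by rewrite coef_map.
Qed.

Lemma xopC f : xop f%:P = (qshift f)%:P * 'X + (qderiv f)%:P.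
Proof. by rewrite /xop !map_polyC. Qed.

Lemma xopCM c F : xop (c%:P%:P * F) = c%:P%:P * xop F.
Proof.
rewrite /xop mulrDr mulrA; congr (_ * _ + _); apply/polyP=> i.
  by rewrite coefCM !coef_map coefCM /= qshiftCM.
by rewrite coefCM !coef_map coefCM /= qderivCM.
Qed.

(** The relation x y = q y x + 1 at the level of operators; it lets the action of the free algebra
    descend to the quotient. *)
Lemma xopY F : xop ('X%:P * F) = q%:P%:P * ('X%:P * xop F) + F.
Proof.
have hs : map_poly qshift ('X%:P * F) = q%:P%:P * 'X%:P * map_poly qshift F.
  apply/polyP=> i; rewrite coef_map -polyCM !coefCM coef_map /= mulrC qshiftMX.
  by rewrite mulrAC.
have hd : map_poly qderiv ('X%:P * F) = q%:P%:P * 'X%:P * map_poly qderiv F + F.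
  apply/polyP=> i; rewrite coefD coef_map -polyCM !coefCM coef_map /= mulrC.
  by rewrite qderivMX mulrAC.
by rewrite /xop hs hd !mulrDr !mulrA addrA.
Qed.

(** The letter [true] is x and [false] is y; the leftmost letter acts last, as in a left module. *)
Definition word_op (m : {fmonom bool}) (F : P) : P :=
  foldr (fun b G => if b then xop G else 'X%:P * G) F (m : seq bool).

Definition free_act (F : P) (z : free2 R) : P :=
  mmap (fun c : R => c%:P%:P) (fun m => word_op m F) z.


Lemma word_opD m : {morph word_op m : F G / F + G}.
Proof.
by case: m => m F G; rewrite /word_op /=; elim: m => //= b m ->; case: b;
  rewrite ?raddfD ?mulrDr.
Qed.

Lemma word_opCM m c F : word_op m (c%:P%:P * F) = c%:P%:P * word_op m F.
Proof.
case: m => m; rewrite /word_op /=; elim: m => //= b m ->.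
by case: b; rewrite ?xopCM // mulrCA.
Qed.

Lemma word_opMX m F : word_op m (F * 'X) = word_op m F * 'X.
Proof.
case: m => m; rewrite /word_op /=; elim: m => //= b m ->.
by case: b; rewrite ?xopMX // mulrA.
Qed.

Lemma word_opM m1 m2 F : word_op (mmul m1 m2) F = word_op m1 (word_op m2 F).
Proof. by rewrite /word_op fmM foldr_cat. Qed.

Lemma free_actU c m F : free_act F << c *g m >> = c%:P%:P * word_op m F.
Proof. exact: (@mmapU _ _ _ (polyC \o polyC)). Qed.

Lemma free_act_zmod_morphism F : zmod_morphism (free_act F).
Proof. exact: (@mmap_is_additive _ _ _ (polyC \o polyC)). Qed.
HB.instance Definition _ F :=
  GRing.isZmodMorphism.Build (free2 R) P (free_act F) (free_act_zmod_morphism F).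


Lemma free_actM z w F : free_act F (z * w) = free_act (free_act F w) z.
Proof.
rewrite malgME raddf_sum /= [RHS]/free_act mmapE; apply: eq_bigr => k _.
rewrite raddf_sum /= [free_act F w]mmapE.
rewrite (big_morph (word_op k) (word_opD k) (id1 := 0)); last first.
  by have := word_opCM k 0 0; rewrite !mul0r.
rewrite mulr_sumr; apply: eq_bigr => l _.
by rewrite free_actU word_opM word_opCM !polyCM mulrA.
Qed.

Lemma free_actCM z c F : free_act (c%:P%:P * F) z = c%:P%:P * free_act F z.
Proof.
rewrite /free_act !mmapE mulr_sumr; apply: eq_bigr => m _ /=.
by rewrite word_opCM mulrCA.
Qed.

Lemma free_actMX z F : free_act (F * 'X) z = free_act F z * 'X.
Proof.
rewrite /free_act !mmapE mulr_suml; apply: eq_bigr => m _ /=.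
by rewrite word_opMX mulrA.
Qed.

Lemma free_act_x F : free_act F (free_x R) = xop F.
Proof. by rewrite free_actU mul1r /word_op fmU. Qed.

Lemma free_act_y F : free_act F (free_y R) = 'X%:P * F.
Proof. by rewrite free_actU mul1r /word_op fmU. Qed.

Lemma free2_constE c : c%:A = << c *g mone >> :> free2 R.
Proof. by rewrite -mul_malgC mulr1. Qed.

Lemma free_act_const F c : free_act F (c%:A : free2 R) = c%:P%:P * F.
Proof. by rewrite free2_constE free_actU /word_op fm1. Qed.

Lemma free_act_scale F c z : free_act F (c *: z) = c%:P%:P * free_act F z.
Proof. by rewrite -mulr_algl free_actM free_act_const. Qed.

Lemma free_act1 F : free_act F 1 = F.
Proof. by rewrite free_actU mul1r /word_op fm1. Qed.

Lemma free_act_rel F : free_act F (qweyl_rel q) = 0.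
Proof.
have hxy : free_act F (free_x R * free_y R) = xop ('X%:P * F).
  by rewrite free_actM free_act_y free_act_x.
have hyx : free_act F (q *: (free_y R * free_x R)) = q%:P%:P * ('X%:P * xop F).
  by rewrite free_act_scale free_actM free_act_x free_act_y.
rewrite /qweyl_rel; move: (_ * _) (_ *: _) hxy hyx => z w hz hw.
rewrite 2!raddfB /= hz hw free_act1 xopY.
by rewrite addrAC addrK subrr.
Qed.

Definition qweyl_act (F : P) (b : W) : P := free_act F (quot2_repr b).

Lemma free_act_ideal z F : z \in ideal2 (qweyl_rel q) -> free_act F z = 0.
Proof.
case/ideal2P=> s ->; rewrite raddf_sum big1 //= => u _.
rewrite !free_actM free_act_rel.
by have := free_actCM u.1 0 0; rewrite !mul0r.
Qed.

Lemma qweyl_actE F z : qweyl_act F (qweyl_pi q z) = free_act F z.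
Proof.
apply/eqP; rewrite -subr_eq0 -raddfB; apply/eqP/free_act_ideal.
by apply/quot2_eq; rewrite quot2_reprK.
Qed.

Lemma qweyl_piK (b : W) : exists z, b = qweyl_pi q z.
Proof. by exists (quot2_repr b); rewrite /qweyl_pi /= quot2_reprK. Qed.

Fact qweyl_act_zmod_morphism F : zmod_morphism (qweyl_act F).
Proof.
move=> b c; case: (qweyl_piK b) (qweyl_piK c) => [z ->] [w ->].
by rewrite -raddfB !qweyl_actE raddfB.
Qed.
HB.instance Definition _ F :=
  GRing.isZmodMorphism.Build W P (qweyl_act F) (qweyl_act_zmod_morphism F).

Lemma qweyl_actM F b c : qweyl_act F (b * c) = qweyl_act (qweyl_act F c) b.
Proof.
case: (qweyl_piK b) (qweyl_piK c) => [z ->] [w ->].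
by rewrite -rmorphM !qweyl_actE free_actM.
Qed.

Lemma qweyl_actMX b F : qweyl_act (F * 'X) b = qweyl_act F b * 'X.
Proof. exact: free_actMX. Qed.

Lemma qweyl_actCM b c F : qweyl_act (c%:P%:P * F) b = c%:P%:P * qweyl_act F b.
Proof. exact: free_actCM. Qed.

Lemma qweyl_act_x F : qweyl_act F x = xop F.
Proof. by rewrite qweyl_actE free_act_x. Qed.

Lemma qweyl_act_y F : qweyl_act F y = 'X%:P * F.
Proof. by rewrite qweyl_actE free_act_y. Qed.

Lemma qweyl_act_const F c : qweyl_act F (const c) = c%:P%:P * F.
Proof. by rewrite qweyl_actE free_act_const. Qed.

Definition of_ypoly (f : {poly R}) : W :=
  qweyl_pi q (map_poly (in_alg (free2 R)) f).[free_y R].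

(** The outer variable of F stands for x, the inner one for y. Evaluation takes place in the free
    algebra, since the quotient is not yet known to be nonzero. *)
Definition of_nf (F : P) : W :=
  qweyl_pi q
    (map_poly (fun f => (map_poly (in_alg (free2 R)) f).[free_y R]) F).[free_x R].

Let yeval (f : {poly R}) := (map_poly (in_alg (free2 R)) f).[free_y R].
Fact yeval_is_zmod_morphism : zmod_morphism yeval.
Proof. by move=> f g; rewrite /yeval raddfB /= hornerD hornerN. Qed.
HB.instance Definition _ :=
  GRing.isZmodMorphism.Build {poly R} (free2 R) yeval yeval_is_zmod_morphism.

Fact of_ypoly_is_zmod_morphism : zmod_morphism of_ypoly.
Proof. by move=> f g; rewrite /of_ypoly raddfB /= hornerD hornerN raddfB. Qed.
HB.instance Definition _ :=
  GRing.isZmodMorphism.Build {poly R} W of_ypoly of_ypoly_is_zmod_morphism.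

Fact of_nf_is_zmod_morphism : zmod_morphism of_nf.
Proof. by move=> f g; rewrite /of_nf -/yeval raddfB /= hornerD hornerN raddfB. Qed.
HB.instance Definition _ :=
  GRing.isZmodMorphism.Build P W of_nf of_nf_is_zmod_morphism.

Lemma of_nfMX F : of_nf (F * 'X) = of_nf F * x.
Proof.
rewrite /of_nf -/yeval.
have -> : map_poly yeval (F * 'X) = map_poly yeval F * 'X.
  apply/polyP=> i; rewrite coef_map !coefMX; case: i => [|i] /=.
    by rewrite raddf0.
  by rewrite coef_map.
by rewrite hornerMX rmorphM.
Qed.

Lemma of_nfC f : of_nf f%:P = of_ypoly f.
Proof. by rewrite /of_nf -/yeval map_polyC hornerC. Qed.

Lemma of_ypolyMX f : of_ypoly (f * 'X) = of_ypoly f * y.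
Proof.
by rewrite /of_ypoly rmorphM /= map_polyX hornerMX rmorphM.
Qed.

Lemma of_ypolyC c : of_ypoly c%:P = const c.
Proof. by rewrite /of_ypoly map_polyC hornerC. Qed.


Fact qweyl_const_is_zmod_morphism : zmod_morphism const.
Proof. by move=> c d; rewrite /qweyl_const scalerBl rmorphB. Qed.
HB.instance Definition _ :=
  GRing.isZmodMorphism.Build R W const qweyl_const_is_zmod_morphism.

Fact qweyl_const_is_monoid_morphism : monoid_morphism const.
Proof.
split=> [|c d]; first by rewrite /qweyl_const scale1r rmorph1.
by rewrite /qweyl_const -rmorphM mulr_algl scalerA.
Qed.
HB.instance Definition _ :=
  GRing.isMonoidMorphism.Build R W const qweyl_const_is_monoid_morphism.

Lemma qweyl_constC c b : const c * b = b * const c.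
Proof.
case: (qweyl_piK b) => z ->.
suff hz : c%:A * z = z * c%:A :> free2 R.
  have piM := rmorphM (qweyl_pi q); exact: etrans (esym (piM _ _)) (etrans (congr1 _ hz) (piM _ _)).
rewrite !free2_constE (monalgE z) mulr_sumr mulr_suml; apply: eq_bigr => m _.
by rewrite !malgM_def !fgmulUU mulrC mul1m mulm1.
Qed.

(** Generators enter on the left, the side on which multiplication of normal forms has explicit
    formulas. *)
Lemma qweyl_ind (Q : W -> Prop) :
    Q 1 -> (forall b, Q b -> Q (x * b)) -> (forall b, Q b -> Q (y * b)) ->
    (forall c b, Q b -> Q (const c * b)) ->
    (forall b d, Q b -> Q d -> Q (b + d)) ->
  forall b, Q b.
Proof.
move=> Q1 Qx Qy Qc QD b; case: (qweyl_piK b) => z ->.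
have Q0 : Q 0 by have := Qc 0 1 Q1; rewrite raddf0 mul0r.
rewrite (monalgE z) (raddf_sum (qweyl_pi q)); apply: (big_ind Q) => // m _.
have hm : << z@_m *g m >> = (z@_m)%:A * << m >> :> free2 R.
  by rewrite free2_constE malgM_def fgmulUU mulr1 mul1m.
have hpi : qweyl_pi q << z@_m *g m >> = const z@_m * qweyl_pi q << m >>.
  exact: etrans (congr1 _ hm) (rmorphM (qweyl_pi q) _ _).
apply: (eq_ind_r Q _ hpi); apply: Qc; case: m {hm hpi} => s.
elim: s => [|a s IH].
  have h1 : << FMonom [::] >> = 1 :> free2 R by rewrite -fmoneE -free2_constE scale1r.
  by apply: (eq_ind_r Q Q1); rewrite h1 rmorph1.
have hs : << FMonom (a :: s) >> = << fmu a >> * << FMonom s >> :> free2 R.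
  rewrite malgM_def fgmulUU mulr1; congr << _ *g _ >>.
  by apply/eqP; rewrite fmP fmM fmU.
have hpi := etrans (congr1 (qweyl_pi q) hs) (rmorphM (qweyl_pi q) _ _).
by apply: (eq_ind_r Q _ hpi); case: a {hs hpi}; [apply: Qx|apply: Qy].
Qed.

End QWeylNormalForm.

(* An interface to the operator representation, abstracting from the quotient
   construction of the algebra so that unification never unfolds it. *)
Record nf_algebra (R : idomainType) (q : R) (W : pzRingType) (x y : W)
    (const : {rmorphism R -> W}) (act : {poly {poly R}} -> {additive W -> {poly {poly R}}})
    (e : {additive {poly {poly R}} -> W}) : Prop := NfAlgebra {
  nfa_rel : x * y = const q * y * x + 1;
  nfa_constC : forall c b, const c * b = b * const c;
  nfa_ind : forall Q : W -> Prop,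
    Q 1 -> (forall b, Q b -> Q (x * b)) -> (forall b, Q b -> Q (y * b)) ->
    (forall c b, Q b -> Q (const c * b)) ->
    (forall b d, Q b -> Q d -> Q (b + d)) -> forall b, Q b;
  nfa_actM : forall F b c, act F (b * c) = act (act F c) b;
  nfa_actMX : forall F b, act (F * 'X) b = act F b * 'X;
  nfa_actCM : forall c F b, act (c%:P%:P * F) b = c%:P%:P * act F b;
  nfa_act_x : forall F, act F x = xop q F;
  nfa_act_y : forall F, act F y = 'X%:P * F;
  nfa_act_const : forall F c, act F (const c) = c%:P%:P * F;
  nfa_eMX : forall F, e (F * 'X) = e F * x;
  nfa_eCMX : forall f, e (f * 'X)%:P = e f%:P * y;
  nfa_eC : forall c, e c%:P%:P = const c
}.

Lemma qweyl_nf_algebra (R : idomainType) (q : R) :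
  nf_algebra q (qweyl_x q) (qweyl_y q) (@qweyl_const R q)
    (@qweyl_act R q) (@of_nf R q).
Proof.
split.
- exact: qweyl_relation.
- exact: qweyl_constC.
- exact: qweyl_ind.
- exact: qweyl_actM.
- by move=> F b; exact: qweyl_actMX.
- by move=> c F b; exact: qweyl_actCM.
- exact: qweyl_act_x.
- exact: qweyl_act_y.
- exact: qweyl_act_const.
- exact: of_nfMX.
- move=> f; exact: etrans (of_nfC _ _) (etrans (of_ypolyMX _ _)
    (congr1 (fun b => b * _) (esym (of_nfC _ _)))).
- move=> c; exact: etrans (of_nfC _ _) (of_ypolyC _ _).
Qed.

Lemma qintSr (R : idomainType) (q : R) k : qint q k.+1 = qint q k + q ^+ k.
Proof. by rewrite /qint big_ord_recr. Qed.

(** The identity f(q y) - f(y) = (q - 1) y (D_q f)(y), without subtraction. *)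
Lemma qshift_qderiv (R : idomainType) (q : R) f :
  qshift q f + qderiv q f * 'X = q%:P * qderiv q f * 'X + f.
Proof.
apply/polyP=> i; rewrite !coefD !coefMX coef_qshift.
case: i => [|i] /=; first by rewrite expr0 mulr1 addr0 add0r.
rewrite coefCM !coef_qderiv -mulrDr [X in _ * X]addrC -qintSr qintS mulrDr mulr1.
by rewrite mulrCA addrC.
Qed.

(** * The monomial basis y^i x^j and multiplicativity of leading monomials *)

Section NfAlgebra.
Variables (R : idomainType) (q : R) (W : pzRingType) (x y : W).
Variables (const : {rmorphism R -> W}).
Variables (act : {poly {poly R}} -> {additive W -> {poly {poly R}}}).
Variables (e : {additive {poly {poly R}} -> W}).
Hypothesis nfa : nf_algebra q x y const act e.

Local Notation P := {poly {poly R}}.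

Lemma nfa_eMXn F k : e (F * 'X^k) = e F * x ^+ k.
Proof.
elim: k => [|k IH]; first by rewrite !expr0 !mulr1.
by rewrite !exprSr !mulrA (nfa_eMX nfa) IH.
Qed.

Lemma nfa_eCMXn f k : e (f * 'X^k)%:P = e f%:P * y ^+ k.
Proof.
elim: k => [|k IH]; first by rewrite !expr0 !mulr1.
by rewrite !exprSr !mulrA (nfa_eCMX nfa) IH.
Qed.

Lemma nfa_e_mon c i j : e ((c%:P * 'X^i)%:P * 'X^j) = const c * y ^+ i * x ^+ j.
Proof. by rewrite nfa_eMXn nfa_eCMXn (nfa_eC nfa). Qed.

Lemma nfa_e1 : e 1 = 1.
Proof. by rewrite -!polyC1 (nfa_eC nfa) rmorph1. Qed.

Lemma nfa_eCM c F : e (c%:P%:P * F) = const c * e F.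
Proof.
elim/poly_ind: F => [|F f IH]; first by rewrite mulr0 !raddf0 mulr0.
rewrite mulrDr mulrA -polyCM !raddfD /= !(nfa_eMX nfa) IH mulrDr mulrA.
congr (_ + _); elim/poly_ind: f => [|f d IHf]; first by rewrite mulr0 !raddf0 mulr0.
rewrite mulrDr mulrA -polyCM !raddfD /= !(nfa_eCMX nfa) IHf !(nfa_eC nfa).
by rewrite mulrDr mulrA rmorphM.
Qed.

Lemma nfa_eyM F : e ('X%:P * F) = y * e F.
Proof.
elim/poly_ind: F => [|F f IH]; first by rewrite mulr0 !raddf0 mulr0.
rewrite mulrDr mulrA -polyCM !raddfD /= !(nfa_eMX nfa) IH mulrDr mulrA.
congr (_ + _); elim/poly_ind: f => [|f c IHf]; first by rewrite mulr0 !raddf0 mulr0.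
rewrite mulrDr mulrA !raddfD /= !(nfa_eCMX nfa) IHf mulrDr mulrA.
by rewrite mulrC (nfa_eCMX nfa) (nfa_eC nfa) (nfa_constC nfa).
Qed.

Lemma nfa_exM F : e (xop q F) = x * e F.
Proof.
elim/poly_ind: F => [|F f IH]; first by rewrite !raddf0 mulr0.
rewrite (raddfD (xop q)) /= xopMX [in RHS](raddfD e) /=.
rewrite (raddfD e (_ * 'X)) /= !(nfa_eMX nfa) IH mulrDr mulrA; congr (_ + _).
rewrite xopC raddfD /= (nfa_eMX nfa).
elim/poly_ind: f => [|f c IHf]; first by rewrite !raddf0 mulr0 mul0r addr0.
(* The Leibniz rule is turned into D_q(f y) = f(q y) + (D_q f) y, which is what moving x past f(y) y
   by the relation produces. *)
rewrite !(raddfD _ (f * 'X)) /= qshiftMX qderivMX -qshift_qderiv qderivC qshiftC.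
rewrite addr0 !raddfD /= -mulrA polyCM nfa_eCM !(nfa_eCMX nfa) !(nfa_eC nfa).
rewrite [x * (_ + _)]mulrDr -(nfa_constC nfa) (mulrA x) -IHf !mulrDl.
rewrite -[_ * x * y]mulrA (nfa_rel nfa) mulrDr mulr1 !mulrA (nfa_constC nfa q).
by rewrite -!addrA; congr (_ + _); rewrite addrC -!addrA; congr (_ + _); rewrite addrC.
Qed.

(** Applying b to the vector 1 reads off its normal form. *)
Definition nf : W -> P := act 1.
HB.instance Definition _ := GRing.Additive.on nf.

Lemma nfa_act_eC F f : act F (e f%:P) = f%:P * F.
Proof.
elim/poly_ind: f F => [|f c IH] F; first by rewrite !raddf0 mul0r.
rewrite !raddfD /= (nfa_eCMX nfa) (nfa_eC nfa) (nfa_actM nfa) (nfa_act_const nfa).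
by rewrite (nfa_act_y nfa) IH mulrDl mulrA -polyCM.
Qed.

Lemma nfa_act_eMX F G f : act F (e (G * 'X + f%:P)) = act (xop q F) (e G) + f%:P * F.
Proof.
by rewrite !raddfD /= (nfa_eMX nfa) (nfa_actM nfa) (nfa_act_x nfa) nfa_act_eC.
Qed.

(** Normally ordered monomials reproduce themselves on 1, because D_q 1 = 0. *)
Lemma eK : cancel e nf.
Proof.
rewrite /nf; elim/poly_ind=> [|F f IH]; first by rewrite !raddf0.
rewrite nfa_act_eMX mulr1 -polyC1 xopC qderivC addr0 qshiftC polyC1.
by rewrite (nfa_actMX nfa) IH.
Qed.

(** The image of [e] contains 1 and is stable under left multiplication by x, y and constants, hence
    is everything; with [eK], the y^i x^j form an R-basis. *)
Lemma nfK : cancel nf e.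
Proof.
move=> b; suff [F ->] : exists F, b = e F by rewrite eK.
elim/(nfa_ind nfa): b => [|b [F ->]|b [F ->]|c b [F ->]|b d [F ->] [G ->]].
- by exists 1; rewrite nfa_e1.
- by exists (xop q F); rewrite nfa_exM.
- by exists ('X%:P * F); rewrite nfa_eyM.
- by exists (c%:P%:P * F); rewrite nfa_eCM.
- by exists (F + G); rewrite raddfD.
Qed.

Lemma nfM b c : nf (b * c) = act (nf c) b.
Proof. exact: (nfa_actM nfa). Qed.

Lemma nf_eq0 b : (nf b == 0) = (b == 0).
Proof.
apply/eqP/eqP=> [h|->]; last exact: raddf0.
by rewrite -[b]nfK h raddf0.
Qed.

Lemma nf_Mx b : nf (b * x) = nf b * 'X.
Proof. by rewrite -{1}[b]nfK -(nfa_eMX nfa) eK. Qed.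

Lemma nf_Mxn b k : nf (b * x ^+ k) = nf b * 'X^k.
Proof. by rewrite -{1}[b]nfK -nfa_eMXn eK. Qed.

Lemma nf_yM b : nf (y * b) = 'X%:P * nf b.
Proof. by rewrite -{1}[b]nfK -nfa_eyM eK. Qed.

Lemma nf_ynM b k : nf (y ^+ k * b) = 'X^k%:P * nf b.
Proof.
elim: k => [|k IH]; first by rewrite !expr0 !mul1r.
by rewrite !exprS -mulrA nf_yM IH polyCM mulrA.
Qed.

Lemma nf_xM b : nf (x * b) = xop q (nf b).
Proof. by rewrite -{1}[b]nfK -nfa_exM eK. Qed.

Lemma nf_constM c b : nf (const c * b) = c%:P%:P * nf b.
Proof. by rewrite -{1}[b]nfK -nfa_eCM eK. Qed.

Lemma nf1 : nf 1 = 1.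
Proof. by rewrite -nfa_e1 eK. Qed.

Hypothesis q_neq0 : q != 0.

Lemma size_qshift f : size (qshift q f) = size f.
Proof.
have [->|f0] := eqVneq f 0; first by rewrite raddf0.
by rewrite size_poly_eq // mulf_neq0 ?expf_neq0 // -lead_coefE lead_coef_eq0.
Qed.

Lemma lead_coef_qshift f : lead_coef (qshift q f) = lead_coef f * q ^+ (size f).-1.
Proof. by rewrite !lead_coefE size_qshift coef_qshift. Qed.

Lemma qshift_eq0 f : (qshift q f == 0) = (f == 0).
Proof. by rewrite -!size_poly_eq0 size_qshift. Qed.

Lemma coef_xop F i :
  (xop q F)`_i = (if i is k.+1 then qshift q F`_k else 0) + qderiv q F`_i.
Proof. by rewrite /xop coefD coefMX !coef_map; case: i. Qed.

Lemma size_xop F : F != 0 -> size (xop q F) = (size F).+1.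
Proof.
move=> F0; have s0 : (0 < size F)%N by rewrite size_poly_gt0.
apply/eqP; rewrite eqn_leq; apply/andP; split.
  apply/leq_sizeP => -[|k] // le_k.
  by rewrite coef_xop !nth_default ?raddf0 ?addr0 // ltnW.
rewrite ltnNge; apply/negP=> /leq_sizeP /(_ _ (leqnn _)).
rewrite coef_xop (nth_default _ (leqnn _)) raddf0 addr0 -(prednK s0) => /eqP.
by rewrite qshift_eq0 -lead_coefE lead_coef_eq0 (negPf F0).
Qed.

Lemma lead_coef_xop F : lead_coef (xop q F) = qshift q (lead_coef F).
Proof.
have [->|F0] := eqVneq F 0; first by rewrite lead_coef0 !raddf0 lead_coef0.
have s0 : (0 < size F)%N by rewrite size_poly_gt0.
rewrite [LHS]lead_coefE size_xop //= -(prednK s0) coef_xop /= prednK //.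
by rewrite -lead_coefE nth_default // raddf0 addr0.
Qed.

(** Each x moved past F twists its leading coefficient by y -> q y, while the q-derivative only
    contributes lower powers of x. F is generalized because G * X acts on F as G acts on
    [xop q F]. *)
Lemma lead_act G F : G != 0 -> F != 0 ->
  (size (act F (e G))).+1 = (size G + size F)%N /\
  lead_coef (act F (e G)) = lead_coef G * iter (size G).-1 (qshift q) (lead_coef F).
Proof.
elim/poly_ind: G F => [|G f IH] F; first by rewrite eqxx.
rewrite nfa_act_eMX mul_polyC.
have [->|G0] := eqVneq G 0.
  rewrite !raddf0 mul0r !add0r polyC_eq0 => f0 F0.
  by rewrite size_scale // lead_coefZ lead_coefC size_polyC f0.
move=> _ F0; have xF0 : xop q F != 0 by rewrite -size_poly_eq0 size_xop.
have [hs hl] := IH _ G0 xF0.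
have sG : (0 < size G)%N by rewrite size_poly_gt0.
rewrite size_xop // addnS in hs; case: hs => hs.
have lt_s : (size (f *: F) < size (act (xop q F) (e G)))%N.
  apply: leq_ltn_trans (size_scale_leq _ _) _.
  by rewrite hs -[X in (X < _)%N]add0n ltn_add2r.
have lt_f : (size f%:P < size (G * 'X)%R)%N.
  by rewrite size_mulX // (leq_ltn_trans (size_polyC_leq1 _)).
rewrite size_polyDl // lead_coefDl // size_polyDl // lead_coefDl // hl hs.
rewrite lead_coefMX size_mulX // addSn; split=> //.
by rewrite lead_coef_xop -iterSr prednK.
Qed.

Lemma nfM_lead b c : b != 0 -> c != 0 ->
  (size (nf (b * c))).+1 = (size (nf b) + size (nf c))%N /\
  lead_coef (nf (b * c)) =
    lead_coef (nf b) * iter (size (nf b)).-1 (qshift q) (lead_coef (nf c)).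
Proof.
rewrite -(nf_eq0 b) -(nf_eq0 c) nfM => b0 c0.
by have := lead_act b0 c0; rewrite nfK.
Qed.

Lemma nfa_domain (b c : W) : b * c = 0 -> b = 0 \/ c = 0.
Proof.
move=> bc0; have [->|b0] := eqVneq b 0; first by left.
have [->|c0] := eqVneq c 0; first by right.
have [hs _] := nfM_lead b0 c0; move: hs; rewrite bc0 raddf0 size_poly0.
rewrite -(nf_eq0 b) -(nf_eq0 c) in b0 c0.
by move: b0 c0; rewrite -!size_poly_gt0; do 2 case: (size _) => // ?; rewrite addnS.
Qed.

Lemma size_iter_qshift k f : size (iter k (qshift q) f) = size f.
Proof. by elim: k => //= k IH; rewrite size_qshift. Qed.

Lemma lead_coef_iter_qshift k f :
  lead_coef (iter k (qshift q) f) = lead_coef f * q ^+ (k * (size f).-1).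
Proof.
elim: k => [|k IH] /=; first by rewrite mulr1.
by rewrite lead_coef_qshift IH size_iter_qshift -mulrA -exprD mulSn addnC.
Qed.

(* Exponents (of x, resp. y) and coefficient of the leading monomial, for the
   lexicographic order with x > y. *)
Definition xdeg b := (size (nf b)).-1.
Definition ydeg b := (size (lead_coef (nf b))).-1.
Definition lc b : R := lead_coef (lead_coef (nf b)).

Lemma lc_eq0 b : (lc b == 0) = (b == 0).
Proof. by rewrite /lc !lead_coef_eq0 nf_eq0. Qed.

Lemma nfa_neq0M (b c : W) : b != 0 -> c != 0 -> b * c != 0.
Proof. by move=> b0 c0; apply/eqP=> /nfa_domain[/eqP|/eqP]; apply/negP. Qed.

Lemma nfa_neq0X (b : W) k : b != 0 -> b ^+ k != 0.
Proof.
move=> b0; elim: k => [|k IH]; first by rewrite expr0 -nf_eq0 nf1 oner_eq0.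
by rewrite exprS nfa_neq0M.
Qed.

Lemma xdegM b c : b != 0 -> c != 0 -> xdeg (b * c) = (xdeg b + xdeg c)%N.
Proof.
move=> b0 c0; have [hs _] := nfM_lead b0 c0; rewrite /xdeg.
rewrite -(nf_eq0 b) -(nf_eq0 c) -!size_poly_gt0 in b0 c0.
move: b0 c0 hs; case: (size (nf b)) => // k; case: (size (nf c)) => // l _ _ [->].
by rewrite addnS.
Qed.

Lemma ydegM b c : b != 0 -> c != 0 -> ydeg (b * c) = (ydeg b + ydeg c)%N.
Proof.
move=> b0 c0; have [_ hl] := nfM_lead b0 c0; rewrite /ydeg hl.
rewrite -(nf_eq0 b) -(nf_eq0 c) -!(lead_coef_eq0 (nf _)) in b0 c0.
rewrite size_mul //; last first.
  by rewrite -size_poly_eq0 size_iter_qshift size_poly_eq0.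
rewrite size_iter_qshift; rewrite -!size_poly_gt0 in b0 c0.
by rewrite -{1}(prednK b0) -{1}(prednK c0) addnS.
Qed.

(** The power of q is the price of moving x^(xdeg b) past y^(ydeg c). *)
Lemma lcM b c : b != 0 -> c != 0 ->
  lc (b * c) = lc b * lc c * q ^+ (xdeg b * ydeg c).
Proof.
move=> b0 c0; have [_ hl] := nfM_lead b0 c0; rewrite /lc hl lead_coefM.
by rewrite lead_coef_iter_qshift mulrA.
Qed.

Lemma xdegX b k : b != 0 -> xdeg (b ^+ k) = (k * xdeg b)%N.
Proof.
move=> b0; elim: k => [|k IH]; first by rewrite expr0 /xdeg nf1 size_poly1.
by rewrite exprS xdegM ?nfa_neq0X // IH mulSn.
Qed.

Lemma ydegX b k : b != 0 -> ydeg (b ^+ k) = (k * ydeg b)%N.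
Proof.
move=> b0; elim: k => [|k IH].
  by rewrite expr0 /ydeg nf1 lead_coef1 size_poly1.
by rewrite exprS ydegM ?nfa_neq0X // IH mulSn.
Qed.

Lemma lcX b k : b != 0 -> exists i, lc (b ^+ k) = lc b ^+ k * q ^+ i.
Proof.
move=> b0; elim: k => [|k [i IH]].
  by exists 0%N; rewrite expr0 /lc nf1 !lead_coef1 mulr1.
rewrite exprS lcM ?nfa_neq0X // IH; eexists.
by rewrite exprS !mulrA -[LHS]mulrA -exprD.
Qed.

Lemma nf_mon c i j : nf (const c * y ^+ i * x ^+ j) = (c%:P * 'X^i)%:P * 'X^j.
Proof. by rewrite -nfa_e_mon eK. Qed.

Lemma nf_mon_lead c i j : c != 0 ->
  let b := const c * y ^+ i * x ^+ j in
  [/\ b != 0, xdeg b = j, ydeg b = i & lc b = c].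
Proof.
move=> c0 b; have f0 : c%:P * 'X^i != 0 :> {poly R}.
  by rewrite mulf_neq0 ?polyC_eq0 // -size_poly_eq0 size_polyXn.
rewrite /xdeg /ydeg /lc -nf_eq0 /b nf_mon; split.
- by rewrite mulf_neq0 ?polyC_eq0 // -size_poly_eq0 size_polyXn.
- by rewrite mul_polyC size_scale // size_polyXn.
- by rewrite lead_coefM lead_coefXn mulr1 lead_coefC mul_polyC size_scale // size_polyXn.
- by rewrite lead_coefM lead_coefXn mulr1 lead_coefC lead_coefM lead_coefXn mulr1 lead_coefC.
Qed.

End NfAlgebra.

(** * Division by leading monomials *)

Lemma size_sub_lead (S : nzRingType) (f g : {poly S}) :
  f != 0 -> size f = size g -> lead_coef f = lead_coef g ->
  (size (f - g)%R < size f)%N.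
Proof.
move=> f0 hs; rewrite !lead_coefE -hs => hl.
have s0 : (0 < size f)%N by rewrite size_poly_gt0.
rewrite -[X in (_ < X)%N](prednK s0) ltnS; apply/leq_sizeP => i le_i.
rewrite coefB; have [->|ne] := eqVneq i (size f).-1; first by rewrite hl subrr.
have le_f : (size f <= i)%N by rewrite -(prednK s0) ltn_neqAle eq_sym ne.
by rewrite !nth_default ?subrr // -hs.
Qed.

Lemma lead_coef_sub (S : nzRingType) (f g : {poly S}) :
    f != 0 -> size f = size g -> lead_coef f != lead_coef g ->
  size (f - g) = size f /\ lead_coef (f - g) = lead_coef f - lead_coef g.
Proof.
move=> f0 hs hl; have hc : (f - g)`_(size f).-1 = lead_coef f - lead_coef g.
  by rewrite coefB !lead_coefE hs.
have hsz : size (f - g) = size f.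
  apply/eqP; rewrite eqn_leq (leq_trans (size_polyD _ _)) ?size_polyN -?hs ?maxnn //=.
  rewrite leqNgt; apply/negP=> lt_s; move: hc; rewrite nth_default; last first.
    by rewrite -ltnS prednK // size_poly_gt0.
  by move/esym/eqP; rewrite subr_eq0 (negPf hl).
by rewrite lead_coefE hsz.
Qed.

Section NfAlgebraOrder.
Variables (R : idomainType) (q : R) (n : nat) (W : pzRingType) (x y : W).
Variables (const : {rmorphism R -> W}).
Variables (act : {poly {poly R}} -> {additive W -> {poly {poly R}}}).
Variables (e : {additive {poly {poly R}} -> W}).
Hypothesis nfa : nf_algebra q x y const act e.
Hypothesis q_prim : n.-primitive_root q.

Local Notation P := {poly {poly R}}.
Local Notation nf := (nf act).
Local Notation xdeg := (xdeg act).
Local Notation ydeg := (ydeg act).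
Local Notation lc := (lc act).

Lemma prim_root_neq0 : q != 0.
Proof.
apply/eqP=> q0; have := prim_expr_order q_prim; rewrite q0.
rewrite expr0n; have := prim_order_gt0 q_prim; case: n => //= k _ /eqP.
by rewrite eq_sym oner_eq0.
Qed.
Let q_neq0 := prim_root_neq0.

Lemma prim_rootX_inv k : q ^+ k * q ^+ (k * n.-1) = 1.
Proof.
rewrite -exprD -mulnS prednK ?(prim_order_gt0 q_prim) // mulnC exprM.
by rewrite (prim_expr_order q_prim) expr1n.
Qed.

(** If the leading coefficients in R[y] agree entirely, the x-degree drops; otherwise only their top
    terms cancel, and the y-degree of the leading coefficient drops. *)
Lemma lex_reduce b c : b != 0 -> c != 0 ->
    xdeg b = xdeg c -> ydeg b = ydeg c -> lc b = lc c ->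
  (size (nf (b - c)%R) < size (nf b))%N \/
  (size (nf (b - c)) = size (nf b) /\
   (size (lead_coef (nf (b - c)%R)) < size (lead_coef (nf b)))%N).
Proof.
move=> b0 c0; have : nf b != 0 by rewrite (nf_eq0 nfa).
have : nf c != 0 by rewrite (nf_eq0 nfa).
have -> : nf (b - c) = nf b - nf c by exact: raddfB.
rewrite /(xdeg) /(ydeg) /(lc); move: (nf b) (nf c) => F G G0 F0 hx hy hl.
have hs : size F = size G.
  by rewrite -(prednK (n := size F)) ?hx ?prednK // size_poly_gt0.
have [h|ne] := eqVneq (lead_coef F) (lead_coef G).
  by left; apply: size_sub_lead.
right; have [-> ->] := lead_coef_sub F0 hs ne; split=> //.
rewrite -!(lead_coef_eq0 F) -!(lead_coef_eq0 G) in F0 G0.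
apply: size_sub_lead => //.
by rewrite -(prednK (n := size (lead_coef F))) ?hy ?prednK // size_poly_gt0.
Qed.

Lemma conductor_lead (d b : W) : completely_integrally_closed R ->
    d != 0 -> b != 0 -> (forall k, exists u, d * b ^+ k = d ^+ k * u) ->
  [/\ (xdeg d <= xdeg b)%N, (ydeg d <= ydeg b)%N & exists s, lc b = lc d * s].
Proof.
move=> cic d0 b0 h.
have h' k : exists2 u, u != 0 & d * b ^+ k = d ^+ k * u.
  have [u hu] := h k; exists u => //; apply/eqP=> u0.
  have := nfa_neq0M nfa q_neq0 d0 (nfa_neq0X nfa q_neq0 k b0).
  by rewrite hu u0 mulr0 eqxx.
have bX0 k := nfa_neq0X nfa q_neq0 k b0.
have dX0 k := nfa_neq0X nfa q_neq0 k d0.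
split.
(* For k > deg d, the inequality deg d + k deg b >= k deg d forces deg b >= deg d. *)
- have [u u0 /(congr1 xdeg)] := h' (xdeg d).+1.
  by rewrite !(xdegM nfa q_neq0) // !(xdegX nfa q_neq0) //; nia.
- have [u u0 /(congr1 ydeg)] := h' (ydeg d).+1.
  by rewrite !(ydegM nfa q_neq0) // !(ydegX nfa q_neq0) //; nia.
(* The leading coefficient of d serves both as common denominator and as divisor; stray powers of q
   are inverted as positive powers. *)
apply: (cic (lc d)); rewrite ?(lc_eq0 nfa) // => k.
have [u u0 /(congr1 lc)] := h' k; rewrite !(lcM nfa q_neq0) //.
have [i ->] := lcX nfa q_neq0 k b0; have [j ->] := lcX nfa q_neq0 k d0.
rewrite mulrA -[LHS]mulrA -exprD; move: (i + _)%N => m hm.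
exists (q ^+ j * lc u * q ^+ (xdeg (d ^+ k) * ydeg u) * q ^+ (m * n.-1)).
by rewrite !mulrA -hm -!mulrA prim_rootX_inv mulr1.
Qed.

(* The approximations to the quotient b / d are built one leading monomial at a
   time; subtracting them keeps the element in M. *)
Lemma conductor_sub (d : W) (M : W -> Prop) : completely_integrally_closed R ->
    d != 0 -> (forall b s, M b -> M (b - d * s)) ->
    (forall b k, M b -> exists u, d * b ^+ k = d ^+ k * u) ->
  forall b, M b -> exists s, b = d * s.
Proof.
move=> cic d0 MB MX b.
have [N le_N] := ubnP (size (nf b)); elim: N => // N IHN in b le_N *.
have [N' le_N'] := ubnP (size (lead_coef (nf b))).
elim: N' => // N' IHN' in b le_N le_N' *.
move=> Mb; have [->|b0] := eqVneq b 0; first by exists 0; rewrite mulr0.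
have [lx ly [s hs]] := conductor_lead cic d0 b0 (fun k => MX b k Mb).
(* The exponent of q that appears in the leading coefficient of d * c; the factor q^(k(n-1)) in c
   compensates for it. *)
pose k := (xdeg d * (ydeg b - ydeg d))%N.
have s0 : s * q ^+ (k * n.-1) != 0.
  rewrite mulf_neq0 ?expf_neq0 //; apply/eqP=> s0.
  by have := lc_eq0 nfa b; rewrite hs s0 mulr0 eqxx (negPf b0).
have [] := nf_mon_lead nfa (ydeg b - ydeg d) (xdeg b - xdeg d) s0.
set c := const _ * _ * _ => c0 cx cy cl.
have dc0 := nfa_neq0M nfa q_neq0 d0 c0.
have [|||lt_s|[eq_s lt_s]] := lex_reduce b0 dc0.
- by rewrite (xdegM nfa) // cx subnKC.
- by rewrite (ydegM nfa) // cy subnKC.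
- rewrite (lcM nfa) // cl cy hs -/k -!mulrA; congr (_ * _).
  by rewrite [_ * q ^+ k]mulrC prim_rootX_inv mulr1.
- have [//|r hr] := IHN (b - d * c) _ (MB _ _ Mb); first exact: leq_trans lt_s _.
  by exists (r + c); rewrite mulrDr -hr subrK.
- have [|//|r hr] := IHN' (b - d * c) _ _ (MB _ _ Mb); first by rewrite eq_s.
    exact: leq_trans lt_s _.
  by exists (r + c); rewrite mulrDr -hr subrK.
Qed.

End NfAlgebraOrder.

(** * The center *)

Section ExpandPowers.
Variables (R : comNzRingType) (n : nat).
Hypothesis n_gt0 : (0 < n)%N.

(** The substitution f(x^n, y^n) on commutative polynomials: the normal form of the corresponding
    central element. *)
Definition expand_powers (f : {poly {poly R}}) : {poly {poly R}} :=
  map_poly (comp_poly 'X^n) f \Po 'X^n.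

Fact expand_powers_is_zmod_morphism : zmod_morphism expand_powers.
Proof. by move=> f g; rewrite /expand_powers !raddfB. Qed.
HB.instance Definition _ := GRing.isZmodMorphism.Build _ _
  expand_powers expand_powers_is_zmod_morphism.

Lemma expand_powersE f : expand_powers f =
  \sum_(i < size f) \sum_(j < size f`_i)
    ((f`_i`_j)%:P * 'X^n ^+ j)%:P * 'X^n ^+ i.
Proof.
rewrite -{1}[f]coefK poly_def raddf_sum /=; apply: eq_bigr => i _.
rewrite /expand_powers map_polyZ /= map_polyXn comp_polyZ comp_Xn_poly.
rewrite -mul_polyC -mulr_suml -rmorph_sum comp_polyE; congr (_%:P * _).
by apply: eq_bigr => j _; rewrite mul_polyC.
Qed.

Lemma coef_expand_powers f i j :
  (expand_powers f)`_i`_j =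
    if (n %| i)%N && (n %| j)%N then f`_(i %/ n)`_(j %/ n) else 0.
Proof.
rewrite coef_comp_poly_Xn //; case: ifP => /= hi; last by rewrite coef0.
by rewrite coef_map /= coef_comp_poly_Xn.
Qed.

Lemma expand_powers_inj : injective expand_powers.
Proof.
move=> f g h; apply/polyP=> i; apply/polyP=> j.
have := congr1 (fun F : {poly {poly R}} => F`_(i * n)`_(j * n)) h.
by rewrite /= !coef_expand_powers !dvdn_mull // !mulnK.
Qed.

(** Multiples of y^i x^j by n-th powers occupy disjoint sets of monomials for distinct residues (i,
    j) modulo n; freeness over the center rests on this. *)
Lemma coef_expand_powersM f i j a b i0 j0 :
    (i < n)%N -> (j < n)%N -> (i0 < n)%N -> (j0 < n)%N ->
  (expand_powers f * ('X^i%:P * 'X^j))`_(b * n + j0)`_(a * n + i0) =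
    if (i == i0) && (j == j0) then f`_b`_a else 0.
Proof.
move=> li lj li0 lj0.
have hd m k k0 : (k < n)%N -> (k0 < n)%N -> (k <= m * n + k0)%N ->
    (n %| m * n + k0 - k)%N = (k == k0).
  move=> lk lk0 le_k; apply/idP/eqP=> [/dvdnP[r hr]|<-]; last first.
    by rewrite addnK dvdn_mull.
  have /(congr1 (modn^~ n)) : (m * n + k0 = r * n + k)%N by rewrite -hr subnK.
  by rewrite /= !modnMDl !modn_small.
rewrite mulrA coefMXn; case: ltnP => [lt_j|le_j].
  by rewrite coef0; case: eqP => //= _; case: eqP => // ej; lia.
rewrite mulrC coefCM mulrC coefMXn; case: ltnP => [lt_i|le_i].
  by case: eqP => //= ei; lia.
rewrite coef_expand_powers !hd // andbC.
by case: eqP => //= ->; case: eqP => //= ->; rewrite !addnK !mulnK.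
Qed.

End ExpandPowers.

Section NfAlgebraCenter.
Variables (R : idomainType) (q : R) (n : nat) (W : pzRingType) (x y : W).
Variables (const : {rmorphism R -> W}).
Variables (act : {poly {poly R}} -> {additive W -> {poly {poly R}}}).
Variables (e : {additive {poly {poly R}} -> W}).
Hypothesis nfa : nf_algebra q x y const act e.
Hypothesis q_prim : n.-primitive_root q.
Hypothesis n_gt1 : (1 < n)%N.

Local Notation P := {poly {poly R}}.
Local Notation nf := (nf act).
Let n_gt0 := ltnW n_gt1.
Let q_neq0 := prim_root_neq0 q_prim.
Let nf_inj : injective nf := can_inj (nfK nfa).

Lemma qint_prim_root : qint q n = 0.
Proof.
have := subrX1 q n; rewrite (prim_expr_order q_prim) subrr => /esym/eqP.
rewrite mulf_eq0 subr_eq0 -(expr1 q) -(prim_order_dvd q_prim) dvdn1.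
by rewrite (gtn_eqF n_gt1) => /eqP.
Qed.

Lemma nfa_central b : b * x = x * b -> b * y = y * b -> b \in @central W.
Proof.
move=> bx by_; apply/centralP; elim/(nfa_ind nfa) => [|a IH|a IH|c a IH|a1 a2 IH1 IH2].
- by rewrite mulr1 mul1r.
- by rewrite mulrA bx -mulrA IH mulrA.
- by rewrite mulrA by_ -mulrA IH mulrA.
- by rewrite mulrA -(nfa_constC nfa) -mulrA IH mulrA.
- by rewrite mulrDr mulrDl IH1 IH2.
Qed.

Lemma const_central c : const c \in @central W.
Proof. by apply/centralP=> b; exact: (nfa_constC nfa). Qed.


(** (q y)^n = y^n and D_q(y^n) = [n]_q y^(n-1) = 0, so x commutes with y^n. *)
Lemma yn_central : y ^+ n \in @central W.
Proof.
apply: nfa_central; last by rewrite -exprSr -exprS.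
have hy : y ^+ n = e ('X^n)%:P.
  by rewrite -[X in X%:P]mul1r (nfa_eCMXn nfa) -!polyC1 (nfa_eC nfa) rmorph1 mul1r.
apply: nf_inj; rewrite (nf_Mx nfa) (nf_xM nfa) hy (eK nfa) xopC.
have -> : qderiv q 'X^n = 0.
  apply/polyP=> i; rewrite coef_qderiv coefXn coef0.
  by case: eqP => [->|_]; rewrite ?qint_prim_root ?mulr0 ?mul0r.
have -> : qshift q 'X^n = 'X^n.
  apply/polyP=> i; rewrite coef_qshift coefXn.
  by case: eqP => [->|_]; rewrite ?(prim_expr_order q_prim) ?mulr1 ?mul0r.
by rewrite polyC0 addr0.
Qed.

Lemma xn_central : x ^+ n \in @central W.
Proof.
apply: nfa_central; first by rewrite -exprSr -exprS.
have h k : x ^+ k.+1 * y = const (q ^+ k.+1) * y * x ^+ k.+1 + const (qint q k.+1) * x ^+ k.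
  elim: k => [|k IH].
    rewrite !expr1 (nfa_rel nfa) expr0 mulr1; congr (_ + _).
    by rewrite /qint big_ord1 expr0 rmorph1.
  rewrite exprS -mulrA IH mulrDr !mulrA -!(nfa_constC nfa) -!mulrA -exprS.
  rewrite (mulrA x y) (nfa_rel nfa) mulrDl mul1r -!mulrA -exprS mulrDr mulrA -rmorphM.
  rewrite -exprSr -addrA -mulrDl -rmorphD addrC [q ^+ _ + _]addrC -qintSr.
  by rewrite addrC mulrA.
rewrite -(prednK n_gt0) h prednK // qint_prim_root (prim_expr_order q_prim).
by rewrite rmorph0 rmorph1 mul0r mul1r addr0.
Qed.

Definition eval_central (f : P) : W :=
  \sum_(i < size f) \sum_(j < size f`_i)
    const f`_i`_j * (x ^+ n) ^+ i * (y ^+ n) ^+ j.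

Lemma eval_central_mem f : eval_central f \in @central W.
Proof.
apply: rpred_sum => i _; apply: rpred_sum => j _.
apply: rpredM; last exact/rpredX/yn_central.
by apply: rpredM; [exact: const_central | exact/rpredX/xn_central].
Qed.

Lemma nf_eval_centralM f b : nf (eval_central f * b) = expand_powers n f * nf b.
Proof.
rewrite expand_powersE mulr_suml raddf_sum mulr_suml; apply: eq_bigr => i _.
rewrite mulr_suml raddf_sum mulr_suml; apply: eq_bigr => j _.
(* [eval_central] writes x^n before y^n, normal forms the opposite; centrality moves x^n to the far
   right. *)
have /centralP xC : (x ^+ n) ^+ i \in @central W by exact/rpredX/xn_central.
rewrite -[_ * b]mulrA -[_ * (_ * b)]mulrA xC mulrA -2!exprM /= (nf_Mxn nfa).
rewrite (nf_constM nfa) (nf_ynM nfa) -!exprM polyCM.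
by rewrite -!mulrA; congr (_ * (_ * _)); rewrite mulrC.
Qed.

Lemma nf_eval_central f : nf (eval_central f) = expand_powers n f.
Proof. by rewrite -[eval_central f]mulr1 nf_eval_centralM (nf1 nfa) mulr1. Qed.

Lemma eval_central_inj : injective eval_central.
Proof.
move=> f g /(congr1 nf); rewrite !nf_eval_central; exact: expand_powers_inj.
Qed.

Lemma eval_centralD f g : eval_central (f + g) = eval_central f + eval_central g.
Proof. by apply: nf_inj; rewrite raddfD /= !nf_eval_central raddfD. Qed.

Lemma eval_central0 : eval_central 0 = 0.
Proof. by apply: nf_inj; rewrite nf_eval_central !raddf0. Qed.

(** Coefficientwise (q^i - 1) f_i = 0, and q^i = 1 only if n divides i. *)
Lemma qshift_fixed f : qshift q f = f -> exists g, f = g \Po 'X^n.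
Proof.
move=> hf; exists (\poly_(i < size f) f`_(i * n)).
apply/polyP=> i; rewrite coef_comp_poly_Xn // coef_poly.
case: ifP => [/divnK hi|ni].
  rewrite hi; case: ltnP => // le_i; apply: nth_default.
  exact: leq_trans le_i (leq_div _ _).
have := congr1 (fun g : {poly R} => g`_i) hf; rewrite /= coef_qshift => /eqP.
rewrite -subr_eq0 -[X in _ - X]mulr1 -mulrBr mulf_eq0 subr_eq0.
by rewrite -(prim_order_dvd q_prim) ni orbF => /eqP.
Qed.

Lemma central_eval b : b \in @central W -> exists f, b = eval_central f.
Proof.
have [N] := ubnP (size (nf b)); elim: N => // N IH in b *.
move=> le_N cb; have [->|b0] := eqVneq b 0; first by exists 0; rewrite eval_central0.
have /centralP bC := cb.
have x0 : x != 0.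
  by rewrite -(nf_eq0 nfa) -[x]mulr1 (nf_xM nfa) (nf1 nfa) -size_poly_eq0 size_xop ?oner_eq0.
have y0 : y != 0.
  rewrite -(nf_eq0 nfa) -[y]mulr1 (nf_yM nfa) (nf1 nfa) mulr1 polyC_eq0.
  by rewrite polyX_eq0.
have nfx : nf x = 'X by rewrite -[x]mul1r (nf_Mx nfa) (nf1 nfa) mul1r.
have nfy : nf y = 'X%:P by rewrite -[y]mulr1 (nf_yM nfa) (nf1 nfa) mulr1.
set F := nf b; pose f := lead_coef F; pose m := (size F).-1.
have f0 : f != 0 by rewrite lead_coef_eq0 /F (nf_eq0 nfa).
have s0 : (0 < size F)%N by rewrite size_poly_gt0 /F (nf_eq0 nfa).
(* Comparing leading coefficients in x b = b x gives f(q y) = f(y). *)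
have [g fg] : exists g, f = g \Po 'X^n.
  apply: qshift_fixed; have [_] := nfM_lead nfa q_neq0 x0 b0.
  rewrite -bC (nf_Mx nfa) lead_coefMX nfx lead_coefX size_polyX mul1r.
  by move=> /= <-.
(* Comparing leading coefficients in b y = y b gives q^m = 1. *)
have nm : (n %| m)%N.
  rewrite (prim_order_dvd q_prim); have [_] := nfM_lead nfa q_neq0 b0 y0.
  rewrite bC (nf_yM nfa) lead_coefM lead_coefC nfy lead_coefC -/F -/f -/m.
  have -> : iter m (qshift q) 'X = (q ^+ m)%:P * 'X.
    elim: m => [|k IHk] /=; first by rewrite mul1r.
    rewrite IHk qshiftCM -['X in LHS]mul1r qshiftMX -polyC1 qshiftC mulr1 mulrA.
    by rewrite -polyCM -exprSr.
  move=> /eqP; rewrite mulrC -subr_eq0 -mulrBr mulf_eq0 (negPf f0) /=.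
  rewrite -[X in X - _]mul1r -mulrBl mulf_eq0 polyX_eq0 orbF -polyC1 -polyCB.
  by rewrite polyC_eq0 subr_eq0 eq_sym.
(* A central element with the same leading term f(y) x^m as b, so that b - c has smaller
   x-degree. *)
pose c := eval_central (g%:P * 'X^(m %/ n)).
have nfc : nf c = f%:P * 'X^m.
  rewrite nf_eval_central /expand_powers rmorphM /= map_polyC map_polyXn /=.
  by rewrite comp_polyM comp_polyC comp_Xn_poly -exprM -fg mulnC divnK.
have c_lt : (size (nf (b - c)) < size (nf b))%N.
  have -> : nf (b - c) = F - f%:P * 'X^m by rewrite -nfc; exact: raddfB.
  apply: size_sub_lead; rewrite -?/F.
  - by rewrite -size_poly_gt0.
  - by rewrite mul_polyC size_scale // size_polyXn prednK.
  - by rewrite lead_coefM lead_coefXn lead_coefC mulr1.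
have [||h hh] := IH (b - c); first exact: leq_trans c_lt _.
  by rewrite rpredB // eval_central_mem.
by exists (h + g%:P * 'X^(m %/ n)); rewrite eval_centralD -hh subrK.
Qed.

Definition center_basis (k : 'I_(n * n)) : W := y ^+ (k %/ n) * x ^+ (k %% n).

Lemma nf_center_basis k : nf (center_basis k) = 'X^(k %/ n)%:P * 'X^(k %% n).
Proof. by rewrite (nf_ynM nfa) -[x ^+ _]mul1r (nf_Mxn nfa) (nf1 nfa) mul1r. Qed.

Lemma center_basis_span b :
  exists c : 'I_(n * n) -> center W, b = \sum_k val (c k) * center_basis k.
Proof.
pose D a := exists c : 'I_(n * n) -> center W, a = \sum_k val (c k) * center_basis k.
have D0 : D 0.
  exists (fun _ => 0); rewrite big1 // => k _; exact: mul0r.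
have DD a1 a2 : D a1 -> D a2 -> D (a1 + a2).
  move=> [c1 ->] [c2 ->]; exists (fun k => c1 k + c2 k).
  by rewrite -big_split; apply: eq_bigr => k _ /=; rewrite -mulrDl.
rewrite -[b](nfK nfa) -[nf b]coefK poly_def raddf_sum.
apply: (big_ind D) => // j _; rewrite -[(nf b)`_j]coefK poly_def.
rewrite scaler_suml raddf_sum; apply: (big_ind D) => // i _.
rewrite -mul_polyC -mul_polyC /= (nfa_e_mon nfa); move: (_`_i) => r.
(* Exponents are divided by n: quotients go into the central coefficient, remainders select the
   basis element. *)
have cc : central_pred (const r * (y ^+ n) ^+ (i %/ n) * (x ^+ n) ^+ (j %/ n)).
  suff: const r * (y ^+ n) ^+ (i %/ n) * (x ^+ n) ^+ (j %/ n) \in @central W by [].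
  apply: rpredM; last exact/rpredX/xn_central.
  by apply: rpredM; [exact: const_central | exact/rpredX/yn_central].
have lt_k : (i %% n * n + j %% n < n * n)%N.
  by have := ltn_pmod i n_gt0; have := ltn_pmod j n_gt0; nia.
pose k := Ordinal lt_k; exists (fun l => if l == k then Center cc else 0).
rewrite (bigD1 k) //= eqxx big1 ?addr0 => [|l /negPf ->]; last exact: mul0r.
rewrite /center_basis /= divnMDl // modnMDl modn_mod (divn_small (ltn_pmod _ _)) // addn0.
have /centralP xC : (x ^+ n) ^+ (j %/ n) \in @central W by exact/rpredX/xn_central.
rewrite -!mulrA; congr (_ * _); rewrite [X in _ = _ * X]xC !mulrA -!exprM.
by rewrite -exprD -mulrA -exprD mulnC -divn_eq addnC mulnC -divn_eq.
Qed.

Lemma center_basis_free (c : 'I_(n * n) -> center W) :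
  \sum_k val (c k) * center_basis k = 0 -> forall k, c k = 0.
Proof.
move=> hc.
have hc' k : exists f, val (c k) = eval_central f by apply: central_eval; case: (c k).
pose g k := sval (cid (hc' k)).
have hg k : val (c k) = eval_central (g k) by exact: svalP (cid (hc' k)).
move=> k0; apply: val_inj; rewrite hg /= -[RHS]eval_central0; congr eval_central.
apply/polyP=> b; apply/polyP=> a; rewrite !coef0.
have k0n : (k0 %/ n < n)%N by rewrite ltn_divLR.
(* Only the term of index k0 contributes to a monomial with these exponent residues. *)
have := congr1 (fun F : P => F`_(b * n + k0 %% n)`_(a * n + k0 %/ n)) (congr1 nf hc).
rewrite /= raddf0 !coef0 raddf_sum !coef_sum (bigD1 k0) //=.
rewrite hg nf_eval_centralM nf_center_basis coef_expand_powersM ?ltn_pmod // !eqxx.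
rewrite big1 ?addr0 // => k ne_k.
rewrite hg nf_eval_centralM nf_center_basis coef_expand_powersM ?ltn_pmod ?ltn_divLR //.
case: ifP => // /andP[/eqP h1 /eqP h2]; case/eqP: ne_k; apply: val_inj => /=.
by rewrite (divn_eq k n) (divn_eq k0 n) h1 h2.
Qed.

End NfAlgebraCenter.

(** * Orders in the tensor algebra *)

Section DomainInverse.
Variables (K : fieldType) (A : algType K).
Hypothesis A_domain : forall a b : A, a * b = 0 -> a = 0 \/ b = 0.

(** While the constant coefficient is 0, a factor a cancels from the relation; once it is nonzero,
    solving for it exhibits a right inverse. *)
Lemma inverse_of_dependent_powers (a : A) n (v : nat -> K) :
    a != 0 -> (exists2 i, (i < n)%N & v i != 0) ->
    \sum_(i < n) v i *: a ^+ i = 0 ->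
  exists w, a * w = 1.
Proof.
move=> a0; elim: n v => [|n IH] v [i lt_i vi0]; first by rewrite ltn0 in lt_i.
rewrite big_ord_recl expr0 (eq_bigr (fun k : 'I_n => a * (v k.+1 *: a ^+ k))).
  rewrite -mulr_sumr; have [v00|v00] := eqVneq (v 0%N) 0.
    rewrite v00 scale0r add0r => /A_domain[a00|h]; first by rewrite a00 eqxx in a0.
    apply: (IH (fun k => v k.+1)) h; case: i lt_i vi0 => [|i] lt_i vi0.
      by rewrite v00 eqxx in vi0.
    by exists i.
  move=> h; exists (- (v 0%N)^-1 *: \sum_(k < n) v k.+1 *: a ^+ k).
  rewrite -scalerAr; have -> : a * (\sum_(k < n) v k.+1 *: a ^+ k) = - (v 0%N)%:A.
    by apply/eqP; rewrite -addr_eq0 addrC h.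
  by rewrite scalerN scaleNr opprK scalerA mulVf // scale1r.
by move=> k _; rewrite -scalerAr -exprS.
Qed.

Lemma domain_inverse n (g : {linear A -> 'rV[K]_n}) (a : A) :
  injective g -> a != 0 -> exists w, a * w = 1.
Proof.
move=> g_inj a0; pose M := \matrix_(i < n.+1) g (a ^+ i).
(* The n + 1 powers 1, a, ..., a^n have coordinates in a space of dimension n. *)
have kM : kermx M != 0.
  by rewrite kermx_eq0 /row_free neq_ltn (leq_ltn_trans (rank_leq_col _)).
have [v vM v0] := rowV0Pn kM; move/sub_kermxP: vM => vM.
pose u k := if insub k is Some i then v 0 i else 0.
have uE (i : 'I_n.+1) : u i = v 0 i by rewrite /u valK.
apply: (@inverse_of_dependent_powers _ n.+1 u a0).
  have [i vi0] : exists i, v 0 i != 0.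
    apply/existsP; rewrite -negb_forall; apply: contra v0 => /forallP h.
    by apply/eqP/rowP=> i; rewrite mxE; apply/eqP; exact: h.
  by exists i; rewrite ?uE.
apply: g_inj; rewrite raddf0 -vM mulmx_sum_row raddf_sum.
by apply: eq_bigr => i _; rewrite rowK uE; exact: (linearZZ g).
Qed.

End DomainInverse.

(** * A domain free of finite rank over its center, inside its central localization: simplicity and
    maximality *)

Section MaximalOrder.
Variables (B : pzRingType) (N : nat) (mon : 'I_N -> B).
Hypothesis mon_span :
  forall b, exists c : 'I_N -> center B, b = \sum_k val (c k) * mon k.
Hypothesis mon_free : forall c : 'I_N -> center B,
  \sum_k val (c k) * mon k = 0 -> forall k, c k = 0.
Hypothesis B_domain : forall b c : B, b * c = 0 -> b = 0 \/ c = 0.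
Hypothesis B_conductor : forall (d : B) (M : B -> Prop), d != 0 ->
  (forall b s, M b -> M (b - d * s)) ->
  (forall b k, M b -> exists u, d * b ^+ k = d ^+ k * u) ->
  forall b, M b -> exists s, b = d * s.

Variables (K : fieldType) (iota : {rmorphism center B -> K}).
Hypothesis iota_frac : is_fraction_field iota.

Lemma iota_neq0 (d : center B) : iota d != 0 -> val d != 0.
Proof. by apply: contra => /eqP d0; rewrite (_ : d = 0) ?rmorph0 //; apply: val_inj. Qed.

Lemma common_denominator n (v : 'I_n -> K) :
  exists2 d : center B, iota d != 0 & forall k, exists c, iota d * v k = iota c.
Proof.
have h k : exists ab : center B * center B, iota ab.2 != 0 /\ v k = iota ab.1 / iota ab.2.
  by have [a [b hab]] := iota_frac.2 (v k); exists (a, b).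
pose ab k := sval (cid (h k)); have hab k := svalP (cid (h k)).
exists (\prod_k (ab k).2).
  by rewrite rmorph_prod; apply/prodf_neq0 => k _; have [] := hab k.
move=> k; exists ((ab k).1 * \prod_(i | i != k) (ab i).2).
rewrite (bigD1 k) //= !rmorphM /=; have [b0 ->] := hab k; rewrite -/(ab k).
by rewrite mulrC mulrA divfK.
Qed.

Definition coord (b : B) : 'I_N -> center B := sval (cid (mon_span b)).

Lemma coordE b : b = \sum_k val (coord b k) * mon k.
Proof. exact: svalP (cid (mon_span b)). Qed.

Lemma coord_uniq (c : 'I_N -> center B) b :
  b = \sum_k val (c k) * mon k -> forall k, c k = coord b k.
Proof.
move=> hb k; apply/eqP; rewrite -subr_eq0; apply/eqP.
apply: (mon_free (c := fun k => c k - coord b k)).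
under eq_bigr do rewrite raddfB mulrBl.
by rewrite sumrB -hb -coordE subrr.
Qed.

Definition coord_row (b : B) : 'rV[K]_N := \row_k iota (coord b k).

Fact coord_row_is_zmod_morphism : zmod_morphism coord_row.
Proof.
move=> b c; apply/rowP=> k; rewrite !mxE -rmorphB; congr (iota _).
rewrite -(@coord_uniq (fun k => coord b k - coord c k)) //.
under eq_bigr do rewrite raddfB mulrBl.
by rewrite sumrB -!coordE.
Qed.
HB.instance Definition _ :=
  GRing.isZmodMorphism.Build B 'rV[K]_N coord_row coord_row_is_zmod_morphism.

Lemma coord_rowZ (c : center B) b : coord_row (val c * b) = iota c *: coord_row b.
Proof.
apply/rowP=> k; rewrite !mxE -rmorphM; congr (iota _).
rewrite -(@coord_uniq (fun k => c * coord b k)) //.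
by rewrite {1}(coordE b) mulr_sumr; apply: eq_bigr => i _; rewrite mulrA.
Qed.

Lemma coord_row_inj : injective coord_row.
Proof.
move=> b c /rowP h; rewrite (coordE b) (coordE c); apply: eq_bigr => k _.
by congr (val _ * _); apply: iota_frac.1; have := h k; rewrite !mxE.
Qed.

Variables (A : algType K) (j : {rmorphism B -> A}).
Hypothesis j_tensor : is_tensor_algebra iota j.

Lemma jZ (c : center B) b : j (val c * b) = iota c *: j b.
Proof. by rewrite rmorphM j_tensor.1 mulr_algl. Qed.

Definition of_row (v : 'rV[K]_N) : A := \sum_k v 0 k *: j (mon k).

Fact of_row_is_linear : linear of_row.
Proof.
move=> c u v; rewrite /of_row scaler_sumr -big_split; apply: eq_bigr => k _.
by rewrite !mxE scalerDl scalerA.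
Qed.
HB.instance Definition _ := GRing.isLinear.Build K 'rV[K]_N A _ of_row of_row_is_linear.

Lemma coord_rowK b : of_row (coord_row b) = j b.
Proof.
rewrite [in RHS](coordE b) rmorph_sum; apply: eq_bigr => k _.
by rewrite mxE jZ.
Qed.

(* By the uniqueness part of the universal property, of_row \o g is the identity
   of A, since both maps restrict to j on B. *)
Lemma tensor_coordinates :
  exists g : {linear A -> 'rV[K]_N}, cancel g of_row /\ forall b, g (j b) = coord_row b.
Proof.
have [g [gj _]] := j_tensor.2 _ (coord_row : {additive B -> 'rV[K]_N}) coord_rowZ.
have [h [_ hu]] := j_tensor.2 _ (j : {additive B -> A}) jZ.
exists g; split=> // a.
have h1 := hu (of_row \o g : {linear A -> A})
  (fun b => etrans (congr1 of_row (gj b)) (coord_rowK b)).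
have h2 := hu (idfun : {linear A -> A}) (fun b => erefl).
exact: etrans (h1 a) (esym (h2 a)).
Qed.

Lemma j_inj : injective j.
Proof.
have [g [_ gj]] := tensor_coordinates => b c h.
by apply: coord_row_inj; rewrite -!gj h.
Qed.

Lemma mon_generates a : exists k : 'I_N -> K, a = \sum_i k i *: j (mon i).
Proof.
have [g [gK _]] := tensor_coordinates.
by exists (fun i => g a 0 i); rewrite -[LHS]gK.
Qed.

Lemma clear_denominator a :
  exists d b, [/\ iota d != 0, val d != 0 & iota d *: a = j b].
Proof.
have [v ->] := mon_generates a; have [d d0 hd] := common_denominator v.
pose c k := sval (cid (hd k)).
exists d, (\sum_k val (c k) * mon k); split=> //; first exact: iota_neq0.
rewrite scaler_sumr rmorph_sum; apply: eq_bigr => k _.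
by rewrite jZ scalerA (svalP (cid (hd k))).
Qed.

Lemma tensor_domain (a b : A) : a * b = 0 -> a = 0 \/ b = 0.
Proof.
move=> ab0; have [d [a' [d0 _ ha]]] := clear_denominator a.
have [f [b' [f0 _ hb]]] := clear_denominator b.
have : j (a' * b') = 0 by rewrite rmorphM -ha -hb -scalerAl -scalerAr ab0 !scaler0.
rewrite -(rmorph0 j) => /j_inj /B_domain[h|h]; [left|right]; apply/eqP.
  by have := ha; rewrite h rmorph0 => /eqP; rewrite scaler_eq0 (negPf d0).
by have := hb; rewrite h rmorph0 => /eqP; rewrite scaler_eq0 (negPf f0).
Qed.

Lemma tensor_central_simple : central_simple A.
Proof.
split.
- by exists N, (j \o mon) => a; have [k ->] := mon_generates a; exists k.
- move=> z; split=> [zC|[k ->] a]; last by rewrite mulr_algl mulr_algr.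
  have [d [b [d0 _ hb]]] := clear_denominator z.
  have cb : central_pred b.
    suff : b \in @central B by []; apply/centralP => a; apply: j_inj.
    by rewrite !rmorphM -hb -scalerAl -scalerAr zC.
  exists (iota (Center cb) / iota d).
  have := j_tensor.1 (Center cb); rewrite /= -hb => h.
  by rewrite mulrC -scalerA -h scalerA mulVf // scale1r.
- move=> I [I0 IB] IM; have [h|h] := pselect (exists2 u, u \in I & u != 0).
    (* A nonzero u in I has a right inverse w, whence a = u (w a) lies in I. *)
    right=> a; case: h => u uI u0; have [g [gK _]] := tensor_coordinates.
    have [w uw] := domain_inverse tensor_domain (can_inj gK) u0.
    by have [_] := IM (w * a) u uI; rewrite mulrA uw mul1r.
  by left=> u uI; apply/eqP/negPn/negP=> u0; apply: h; exists u.
Qed.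

Lemma image_is_order : is_order iota (image_pred j).
Proof.
have imP a : reflect (exists b, j b = a) (a \in image_pred j) by exact: asboolP.
split.
- split=> [|a b /imP[a' <-] /imP[b' <-]|a b /imP[a' <-] /imP[b' <-]]; apply/imP.
  + by exists 1; rewrite rmorph1.
  + by exists (a' - b'); rewrite rmorphB.
  + by exists (a' * b'); rewrite rmorphM.
- exists N, (j \o mon) => a; split=> [/imP[b <-]|[c ->]].
    exists (coord b); rewrite [in LHS](coordE b) rmorph_sum.
    by apply: eq_bigr => k _; rewrite jZ.
  apply/imP; exists (\sum_k val (c k) * mon k); rewrite rmorph_sum.
  by apply: eq_bigr => k _; rewrite jZ.
- move=> a; have [k ->] := mon_generates a; exists N, k, (j \o mon); split=> // i.
  by apply/imP; exists (mon i).
Qed.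

Lemma order_conductor (L : {pred A}) : is_order iota L ->
  exists2 d : center B, iota d != 0 & forall a, a \in L -> exists b, iota d *: a = j b.
Proof.
case=> _ [n [e he]] _.
have h k : exists db : center B * B, iota db.1 != 0 /\ iota db.1 *: e k = j db.2.
  by have [d [b [d0 _ hb]]] := clear_denominator (e k); exists (d, b).
pose db k := sval (cid (h k)); have hdb k := svalP (cid (h k)).
exists (\prod_k (db k).1).
  by rewrite rmorph_prod; apply/prodf_neq0 => k _; have [] := hdb k.
move=> a /he[c ->].
exists (\sum_k val (c k * \prod_(i | i != k) (db i).1) * (db k).2).
rewrite scaler_sumr rmorph_sum; apply: eq_bigr => k _; rewrite jZ.
rewrite -(hdb k).2 -/(db k) !scalerA; congr (_ *: _).
by rewrite [X in iota X * _](bigD1 k) //= !rmorphM /= mulrC mulrA mulrAC -mulrA.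
Qed.

Lemma image_is_maximal_order : is_maximal_order iota (image_pred j).
Proof.
have imP a : reflect (exists b, j b = a) (a \in image_pred j) by exact: asboolP.
split=> [|L oL sL a]; first exact: image_is_order.
apply/idP/idP=> [/sL //|aL].
have [d d0 hd] := order_conductor oL; have [[L1 LB LM] _ _] := oL.
have vd0 := iota_neq0 d0.
(* The numerators over d of elements of L; stability under b -> b - d s holds because L contains the
   image of B. *)
pose M b := exists2 l, l \in L & iota d *: l = j b.
have LX l k : l \in L -> l ^+ k \in L.
  by move=> lL; elim: k => [|k IH]; rewrite ?expr0 // exprS LM.
have [b hb] := hd a aL.
have [||s hs] := @B_conductor (val d) M vd0 _ _ b (ex_intro2 _ _ a aL hb).
- move=> b' s [l lL hl]; exists (l - j s).
    by apply: LB => //; apply: sL; apply/imP; exists s.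
  by rewrite scalerBr hl rmorphB jZ.
(* With b' = d l, the element u = d l^k lies in B and d b'^k = d^k u. *)
- move=> b' k [l lL hl]; have [u hu] := hd _ (LX l k lL).
  exists u; apply: j_inj; rewrite jZ rmorphXn -hl exprZn.
  have -> : val d ^+ k = val (d ^+ k) by rewrite rmorphXn.
  by rewrite jZ -hu !scalerA rmorphXn mulrC.
apply/imP; exists s; apply: (scalerI d0); by rewrite hb hs jZ.
Qed.

End MaximalOrder.

(** * The q-Weyl algebra over a domain, at a primitive root of unity *)

Section QWeylOverDomain.
Variables (R : idomainType) (q : R) (n : nat).
Hypotheses (q_prim : n.-primitive_root q) (n_gt1 : (1 < n)%N).
Let nfa := qweyl_nf_algebra q.
Let q_neq0 := prim_root_neq0 q_prim.

Lemma eval_powersE f :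
  eval_powers q n f = eval_central n (qweyl_x q) (qweyl_y q) (@qweyl_const R q) f.
Proof. by apply: eq_bigr => i _; apply: eq_bigr => j _; congr (_ * _ * _). Qed.

Lemma qweyl_eval_inj : injective (@eval_powers R q n).
Proof.
move=> f g h; apply: (eval_central_inj nfa q_prim n_gt1).
exact: etrans (esym (eval_powersE f)) (etrans h (eval_powersE g)).
Qed.

Lemma qweyl_centralP (b : qweyl q) :
  b \in @central (qweyl q) <-> exists f, b = eval_powers q n f.
Proof.
split=> [cb|[f ->]].
  have [f bE] := central_eval nfa q_prim n_gt1 cb; exists f.
  exact: etrans bE (esym (eval_powersE f)).
apply: (eq_ind_r (fun a => a \in @central (qweyl q)) _ (eval_powersE f)).
exact: (eval_central_mem nfa q_prim n_gt1 f).
Qed.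

Definition qweyl_basis : 'I_(n * n) -> qweyl q :=
  center_basis (qweyl_x q) (qweyl_y q).

Lemma qweyl_basis_span (b : qweyl q) :
  exists c : 'I_(n * n) -> center (qweyl q), b = \sum_k val (c k) * qweyl_basis k.
Proof. exact: (center_basis_span nfa q_prim n_gt1 b). Qed.

Lemma qweyl_basis_free (c : 'I_(n * n) -> center (qweyl q)) :
  \sum_k val (c k) * qweyl_basis k = 0 -> forall k, c k = 0.
Proof. exact: (@center_basis_free _ _ _ _ _ _ _ _ _ nfa q_prim n_gt1 c). Qed.

Lemma qweyl_domain (b c : qweyl q) : b * c = 0 -> b = 0 \/ c = 0.
Proof. exact: (nfa_domain nfa q_neq0). Qed.

Lemma qweyl_conductor (d : qweyl q) (M : qweyl q -> Prop) :
    completely_integrally_closed R -> d != 0 ->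
    (forall b s, M b -> M (b - d * s)) ->
    (forall b k, M b -> exists u, d * b ^+ k = d ^+ k * u) ->
  forall b, M b -> exists s, b = d * s.
Proof. exact: (conductor_sub nfa q_prim). Qed.

End QWeylOverDomain.

(** * Z[rho] as a quotient of Z[X], and the specialization to B *)

Section ZrhoPresentation.
Variable p : nat.
Hypothesis p_prime : prime p.

Definition Zrho_of_poly : {rmorphism {poly int} -> Zrho p} :=
  @in_qpoly int (cyclo_prime p).

Lemma Zrho_of_poly_ker f :
  Zrho_of_poly f = 0 <-> exists g, f = g * cyclo_prime p.
Proof.
have mkE := mk_monic_cyclo_prime (prime_gt1 p_prime).
have mon : cyclo_prime p \is monic by rewrite -mkE monic_mk_monic.
split=> [h|[g ->]].
  apply/(Pdiv.RingMonic.rdvdpP mon)/Pdiv.Ring.rmodp_eq0P; rewrite -{1}mkE.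
  exact: (congr1 val h).
by apply: val_inj; rewrite /= mkE Pdiv.RingMonic.rmodp_mull.
Qed.

Lemma Zrho_of_poly_surj (z : Zrho p) :
  exists2 f : {poly int}, (size f < p)%N & Zrho_of_poly f = z.
Proof.
have mkE := mk_monic_cyclo_prime (prime_gt1 p_prime).
exists (val z).
  by apply: leq_trans (size_mk_monic z) _; rewrite mkE size_cyclo_prime.
by apply: val_inj; apply: in_qpoly_small; exact: size_mk_monic.
Qed.

Definition Zrho_domain := cyclo_domain p_prime Zrho_of_poly_ker Zrho_of_poly_surj.

(** Units and inverses are chosen classically, to complete the integral domain structure over which
    normal forms are developed. *)
Definition Zrho_unit (z : Zrho p) : bool := `[< exists w, w * z = 1 >].
Definition Zrho_inv (z : Zrho p) : Zrho p :=
  if pselect (exists w, w * z = 1) is left h then sval (cid h) else z.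

(* The integral domain structure depends on the primality of p, hence the alias. *)
Definition ZrhoD : Type := Zrho p.
HB.instance Definition _ := GRing.ComNzRing.copy ZrhoD (Zrho p).

Fact Zrho_mulVx : {in (Zrho_unit : {pred ZrhoD}), left_inverse 1 (Zrho_inv : ZrhoD -> ZrhoD) *%R}.
Proof.
move=> z /asboolP hz; rewrite /Zrho_inv; case: pselect => // h.
exact: svalP (cid h).
Qed.
Fact Zrho_unitPl (z w : ZrhoD) : w * z = 1 -> Zrho_unit z.
Proof. by move=> h; apply/asboolP; exists w. Qed.
Fact Zrho_inv_out : {in [predC (Zrho_unit : {pred ZrhoD})], (Zrho_inv : ZrhoD -> ZrhoD) =1 id}.
Proof.
move=> z; rewrite inE /= => nz; rewrite /Zrho_inv; case: pselect => // h.
by case/negP: nz; apply/asboolP.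
Qed.
HB.instance Definition _ := GRing.ComNzRing_hasMulInverse.Build ZrhoD
  Zrho_mulVx Zrho_unitPl Zrho_inv_out.

Fact ZrhoD_integral : GRing.integral_domain_axiom ZrhoD.
Proof.
move=> a b /Zrho_domain[|] ->; rewrite eqxx ?orbT //.
Qed.
HB.instance Definition _ := GRing.ComUnitRing_isIntegral.Build ZrhoD ZrhoD_integral.

Lemma rho_primitive : p.-primitive_root (rho p : ZrhoD).
Proof. exact: (root_primitive p_prime Zrho_of_poly_ker Zrho_of_poly_surj). Qed.

Lemma ZrhoD_cic : completely_integrally_closed ZrhoD.
Proof. exact: (cyclo_completely_integrally_closed p_prime Zrho_of_poly_ker Zrho_of_poly_surj). Qed.

Let p_gt1 := prime_gt1 p_prime.

Lemma eval_powers_inj : injective (@eval_powers (Zrho p) (rho p) p).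
Proof. exact: (@qweyl_eval_inj ZrhoD _ _ rho_primitive p_gt1). Qed.

Lemma B_centralP (b : B p) :
  b \in @central (B p) <-> exists f, b = eval_powers (rho p) p f.
Proof. exact: (@qweyl_centralP ZrhoD _ _ rho_primitive p_gt1). Qed.

Definition B_basis : 'I_(p * p) -> B p := @qweyl_basis ZrhoD (rho p) p.

Lemma B_basis_span (b : B p) :
  exists c : 'I_(p * p) -> center (B p), b = \sum_k val (c k) * B_basis k.
Proof. exact: (@qweyl_basis_span ZrhoD _ _ rho_primitive p_gt1). Qed.

Lemma B_basis_free (c : 'I_(p * p) -> center (B p)) :
  \sum_k val (c k) * B_basis k = 0 -> forall k, c k = 0.
Proof. exact: (@qweyl_basis_free ZrhoD _ _ rho_primitive p_gt1). Qed.

Lemma B_domain (b c : B p) : b * c = 0 -> b = 0 \/ c = 0.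
Proof. exact: (@qweyl_domain ZrhoD _ _ rho_primitive). Qed.

Lemma B_conductor (d : B p) (M : B p -> Prop) : d != 0 ->
  (forall b s, M b -> M (b - d * s)) ->
  (forall b k, M b -> exists u, d * b ^+ k = d ^+ k * u) ->
  forall b, M b -> exists s, b = d * s.
Proof. exact: (@qweyl_conductor ZrhoD _ _ rho_primitive _ _ ZrhoD_cic). Qed.

End ZrhoPresentation.

Theorem theorem3p4 (p : nat) (p_prime : prime p) :
  (* C, the center of B, is the polynomial ring Z[rho][x^p, y^p] *)
  (injective (@eval_powers (Zrho p) (rho p) p) /\
   forall b : B p,
     b \in @central (B p) <->
     exists f : {poly {poly Zrho p}}, b = eval_powers (rho p) p f)
  /\
  forall (K : fieldType) (iota : {rmorphism center (B p) -> K}),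
    is_fraction_field iota ->
  forall (A : algType K) (j : {rmorphism B p -> A}),
    is_tensor_algebra iota j ->
    [/\ central_simple A,
        injective j
      & is_maximal_order iota (image_pred j)].
Proof.
split; first by split; [exact: eval_powers_inj | exact: B_centralP].
move=> K iota iota_frac A j j_tensor.
have span := B_basis_span p_prime; have free := @B_basis_free _ p_prime.
have dom := @B_domain _ p_prime; have cond := @B_conductor _ p_prime.
split.
- exact: (tensor_central_simple span free dom iota_frac j_tensor).
- exact: (j_inj span free iota_frac j_tensor).
- exact: (image_is_maximal_order span free cond iota_frac j_tensor).
Qed.
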